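(* There is an absolute constant $r_0$ such that the following holds. Let $k,r,\Delta$ be positive integers with $r\geq r_0$ and $\Delta\geq 3$. Let $G$ be a graph (with at least one vertex) not containing $K_{k,k}$ as a subgraph, with maximum degree at most $\Delta$ and average degree at least $80r^2\log\log\Delta$. Then $G$ has a $64$-almost-regular subgraph with average degree at least $\frac{r}{160(k+1)\log r}$.
   Context: Logarithms are to base $2$. A graph is $K$-almost-regular if its maximum degree is at most $K$ times its minimum degree; subgraphs are non-empty; average degree is $2e/|V|$. *)

(* Defs.v *)
From mathcomp Require Import all_boot.
From Stdlib Require Import Reals.
Set Implicit Arguments. Unset Strict Implicit. Unset Printing Implicit Defensive.

Definition log2 (x : R) : R := (ln x / ln 2)%R.

Section Graphs.
Variable V : finType.

Definition simple_graph (e : rel V) : Prop :=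
  symmetric e /\ irreflexive e.

Definition deg (e : rel V) (x : V) : nat := #|[set y | e x y]|.

Definition nedges (e : rel V) : nat :=
  #|[set E : {set V} | [exists x, exists y,
       [&& x != y, e x y & E == [set x; y]]]]|.

Definition avg_deg (S : {set V}) (F : rel V) : R :=
  (2 * INR (nedges F) / INR #|S|)%R.

Definition is_subgraph (e : rel V) (S : {set V}) (F : rel V) : Prop :=
  S != set0 /\ symmetric F /\
  (forall x y, F x y -> e x y) /\
  (forall x y, F x y -> (x \in S) && (y \in S)).

Definition almost_regular (K : nat) (S : {set V}) (F : rel V) : Prop :=
  forall x y, x \in S -> y \in S -> deg F x <= K * deg F y.

Definition contains_Kkk (e : rel V) (k : nat) : Prop :=
  exists A B : {set V}, [/\ #|A| = k, #|B| = k, [disjoint A & B] &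
    forall a b, a \in A -> b \in B -> e a b].

End Graphs.

(* Main.v *)
(* A vertex set pair [A], [B] is sampled so that every sampled vertex has bounded
   expected degree; truncating the few overfull vertices and deleting vertices of
   low degree then leaves an almost-regular graph.  After passing to a bipartite
   graph in which all [a \in A] have degree [delta ~ r^2 log log Delta] and
   [#|B| <= #|A|], the vertices of [B] are split by degree.
   - Degrees at most [2^(O(r log r log log Delta))]: one of the dyadic classes of
     [B] carries enough edges, and a pair [A', B'] maximising
     [e(A', B')^2 / (|A'| |B'|)] has light degree tails on both sides, so it
     suffices to sample its larger side.
   - Larger degrees: there are only [r log log Delta] windows [[D, D^(1 + 1/r)]),
     so in one of them [A] retains degree [~ r].  Sample [b] with probability
     [q b] proportional to its degree, and keep [a] only if all its neighbours
     were sampled, with a further bias making [P(a kept)] constant; then every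
     sampled [b] has the same expected degree.  Its second moment is controlled
     once the neighbourhood of [a] contains no set whose codegree is much larger
     than expected.  As the graph is K_{k,k}-free, such heavy sets inside the
     neighbourhood of a typical [a] can be destroyed at the price of a factor
     [O(k)] in the degree. *)
From mathcomp Require Import all_boot all_order all_algebra.
From mathcomp Require Import zify ring lra.
Require Import Defs.
Set Implicit Arguments. Unset Strict Implicit. Unset Printing Implicit Defensive.
Import Order.TTheory GRing.Theory Num.Theory.

(** * Degree sums and minimum degree *)

Section DegreeSums.
Variable V : finType.
Implicit Types (e F : rel V) (S : {set V}).

Lemma degE F x : deg F x = \sum_y F x y.
Proof.
by rewrite /deg -sum1dep_card big_mkcond; apply: eq_bigr => y _; case: (F x y).
Qed.

(** Ordered adjacent pairs are grouped by their underlying edge; irreflexivity makes every fibre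
    have exactly two elements. *)
Lemma sum_deg F : symmetric F -> irreflexive F ->
  \sum_x deg F x = 2 * nedges F.
Proof.
move=> symF irrF.
pose P := [set p : V * V | F p.1 p.2].
pose f (p : V * V) := [set p.1; p.2].
have -> : \sum_x deg F x = \sum_(p in P) 1.
  under eq_bigr => x _ do rewrite degE.
  rewrite pair_big /= [RHS]big_mkcond; apply: eq_bigr => -[x y] _.
  by rewrite inE /=; case: (F x y).
rewrite /nedges; set ES := [set E | _].
rewrite (partition_big f (mem ES)) /=; last first.
  move=> [x y]; rewrite !inE /= => Fxy; apply/existsP; exists x.
  apply/existsP; exists y; rewrite Fxy eqxx !andbT.
  by apply: contraTneq Fxy => ->; rewrite irrF.
rewrite mulnC -sum_nat_const; apply: eq_bigr => E.
rewrite inE => /existsP[x /existsP[y /and3P[nxy Fxy /eqP->]]].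
rewrite sum1dep_card.
have -> : [set p | (p \in P) && (f p == [set x; y])] = [set (x, y); (y, x)].
  apply/setP => -[u v]; rewrite !inE /f /= !xpair_eqE.
  apply/andP/orP => [[Fuv /eqP E2]|].
    have : u \in [set x; y] by rewrite -E2 !inE eqxx.
    have : v \in [set x; y] by rewrite -E2 !inE eqxx orbT.
    have nuv : u != v by apply: contraTneq Fuv => ->; rewrite irrF.
    rewrite !inE => /orP[]/eqP ev /orP[]/eqP eu; subst; rewrite ?eqxx in nuv *;
      by [left | right |].
  case=> /andP[/eqP-> /eqP->]; first by rewrite Fxy eqxx.
  by rewrite symF Fxy setUC eqxx.
by rewrite cards2 xpair_eqE negb_and nxy.
Qed.

End DegreeSums.

Local Open Scope ring_scope.

Section Cleaning.
Variables (V : finType) (R : realFieldType).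
Implicit Types (e F : rel V) (S : {set V}).

(** The average degree is expressed through the degree sum, without division and over any ordered
    field, so that the probabilistic arguments can run over [rat]. *)
Definition has_regular_subgraph e (rho : R) : Prop :=
  exists (S : {set V}) (F : rel V),
    [/\ is_subgraph e S F, almost_regular 64 S F
      & rho * #|S|%:R <= (\sum_x deg F x)%:R].

(** In a minimal non-empty set of average degree at least [rho], every degree is at least [rho / 2]:
    deleting a vertex of degree [d] lowers the degree sum by [2 * d] and the required bound by
    [rho]. The cap [32 * rho] on the maximum degree is 64 times this minimum. *)
Lemma min_degree_cleaning e F S0 (c : nat) (rho : R) :
  irreflexive e -> symmetric F -> (forall x y, F x y -> e x y) ->
  (forall x y, F x y -> (x \in S0) && (y \in S0)) ->
  (forall x, deg F x <= c)%N -> 0 < rho -> c%:R <= 32 * rho ->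
  S0 != set0 -> rho * #|S0|%:R <= (\sum_x deg F x)%:R ->
  has_regular_subgraph e rho.
Proof.
move=> irre symF subF suppF degF rho0 crho S0n0 avgF.
pose arcs S := (\sum_(x in S) \sum_(y in S) F x y)%N.
pose P S := (S != set0) && (rho * #|S|%:R <= (arcs S)%:R).
have irrF x : F x x = false.
  by apply/negP => /subF; rewrite irre.
have arcs0 : arcs S0 = (\sum_x deg F x)%N.
  rewrite /arcs big_mkcond; apply: eq_bigr => x _; rewrite degE.
  case: ifPn => xS.
    rewrite big_mkcond; apply: eq_bigr => y _; case: ifPn => // yS.
    by apply/esym/eqP; rewrite eqb0; apply: contra yS => /suppF/andP[].
  rewrite big1 // => y _; apply/eqP; rewrite eqb0.
  by apply: contra xS => /suppF/andP[].
have [S /minsetP[/andP[Sn0 avgS] Smin] _] : {S | minset P S & S \subset S0}.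
  by apply: minset_exists; rewrite /P S0n0 arcs0.
pose d v := (\sum_(y in S) F v y)%N.
have arcsD v : v \in S -> (arcs S = arcs (S :\ v) + 2 * d v)%N.
  move=> vS; rewrite /arcs (big_setD1 v vS) /= -/(d v).
  under [X in (_ + X)%N]eq_bigr => x _ do rewrite (big_setD1 v vS) /=.
  rewrite big_split /= [X in (_ + (X + _))%N](_ : _ = d v); first lia.
  rewrite /d (big_setD1 v vS) /= irrF add0n.
  by apply: eq_bigr => x _; rewrite symF.
have dlow v : v \in S -> rho <= 2 * (d v)%:R.
  move=> vS; have [Sv0|Svn0] := eqVneq (S :\ v) set0.
    have eS : S = [set v] by rewrite -(setD1K vS) Sv0 setU0.
    move: avgS; rewrite /arcs eS !big_set1 irrF cards1 /=.
    by move=> h; exfalso; move: rho0; rewrite ltNge; move: h; rewrite mulr1 => ->.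
  have : ~~ P (S :\ v).
    apply/negP => PSv; have := Smin _ PSv (subD1set _ _) => eSv.
    by move: vS; rewrite -eSv !inE eqxx.
  rewrite /P Svn0 /= -ltNge => lt.
  move: avgS; rewrite (arcsD v vS) (cardsD1 v S) vS natrD mulrDr mulr1.
  rewrite natrD natrM => h; lra.
pose F' x y := [&& x \in S, y \in S & F x y].
have degF' x : deg F' x = if x \in S then d x else 0%N.
  rewrite degE /F'; case: ifP => xS; last by rewrite big1.
  by rewrite /d [RHS]big_mkcond; apply: eq_bigr => y _; case: (y \in S).
have dc v : (d v <= c)%N.
  apply: leq_trans (degF v); rewrite degE /d big_mkcond; apply: leq_sum => y _.
  by case: ifP.
exists S, F'; split.
- split=> //; split; first by move=> x y; rewrite /F' symF andbCA.
  split=> x y; rewrite /F' => /and3P[xS yS Fxy]; first exact: subF.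
  by rewrite xS yS.
- move=> x y xS yS; rewrite !degF' xS yS.
  rewrite -(ler_nat R) natrM; have := dlow _ yS.
  have : (d x)%:R <= c%:R :> R by rewrite ler_nat.
  by lra.
- apply: le_trans avgS _; rewrite ler_nat /arcs [leqLHS]big_mkcond.
  by apply: leq_sum => x _; rewrite degF'; case: ifP.
Qed.

End Cleaning.

(** * Random sampling *)

Section RandomSubset.
Variables (V : finType) (R : realFieldType).
Implicit Types (X Y : {set V}) (q : V -> R).

(* The probability that the random set containing each [v] independently with
   probability [q v] equals [X]. *)
Definition subset_weight q X : R :=
  \prod_v (if v \in X then q v else 1 - q v).

(** This is the probability that the random set contains [Y]. In the expansion of the product of
    [q v + G v], a zero [G] on [Y] kills the sets that miss a point of [Y], while the factors off
    [Y] equal 1. *)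
Lemma sum_subset_weight q Y :
  \sum_(X : {set V} | Y \subset X) subset_weight q X = \prod_(v in Y) q v.
Proof.
pose G v := if v \in Y then 0 else 1 - q v.
transitivity (\prod_v (q v + G v)).
  rewrite bigA_distr big_mkcond /=; apply: eq_bigr => X _.
  case: ifPn => [YX|].
    apply: eq_bigr => v _; case: ifPn => // vX; rewrite /G ifN //.
    by apply: contra vX => /(subsetP YX).
  case/subsetPn => v vY vX; rewrite (bigD1 v) //= (negbTE vX) /G vY mul0r //.
rewrite [RHS]big_mkcond; apply: eq_bigr => v _; rewrite /G.
by case: ifP => _; rewrite ?addr0 // addrC subrK.
Qed.

Lemma sum_prod_subset (x : V -> R) Y :
  \sum_(X : {set V} | X \subset Y) \prod_(v in X) x v = \prod_(v in Y) (1 + x v).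
Proof.
pose F v := if v \in Y then x v else 0.
transitivity (\prod_v (F v + 1)).
  rewrite bigA_distr big_mkcond /=; apply: eq_bigr => X _.
  case: ifPn => [YX|].
    rewrite [LHS]big_mkcond; apply: eq_bigr => v _; case: ifPn => // vX.
    by rewrite /F (subsetP YX).
  by case/subsetPn => v vX vY; rewrite (bigD1 v) //= vX /F (negbTE vY) mul0r.
rewrite [RHS]big_mkcond; apply: eq_bigr => v _; rewrite /F.
by case: ifP => _; rewrite ?add0r // addrC.
Qed.

Lemma subset_weight_ge0 q X :
  (forall v, 0 <= q v <= 1) -> 0 <= subset_weight q X.
Proof.
move=> q01; apply: prodr_ge0 => v _; have /andP[q0 q1] := q01 v.
by case: ifP; rewrite ?subr_ge0.
Qed.

Lemma exists_pos_of_sum (I : finType) (w f : I -> R) :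
  (forall i, 0 <= w i) -> 0 < \sum_i w i * f i -> exists i, 0 < f i.
Proof.
move=> w0; case: (pickP (fun i => 0 < f i)) => [i fi _|nf]; first by exists i.
rewrite ltNge sumr_le0 // => i _.
by rewrite mulr_ge0_le0 // leNgt nf.
Qed.

(** Linearity of expectation for the number of [a] whose set [Y a] is entirely sampled. *)
Lemma sum_subset_weight_nat q (P : pred V) (Y : V -> {set V}) :
  \sum_X subset_weight q X * (\sum_(a | P a) (Y a \subset X : nat))%:R
    = \sum_(a | P a) \prod_(v in Y a) q v.
Proof.
under eq_bigr => X _ do rewrite natr_sum mulr_sumr.
rewrite exchange_big /=; apply: eq_bigr => a _.
rewrite -sum_subset_weight [RHS]big_mkcond; apply: eq_bigr => X _.
by case: ifP; rewrite ?mulr1 ?mulr0.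
Qed.

End RandomSubset.

Definition take_set (V : finType) n (S : {set V}) : {set V} :=
  [set x in take n (enum S)].

Lemma take_set_sub (V : finType) n (S : {set V}) : take_set n S \subset S.
Proof. by apply/subsetP => x; rewrite inE => /mem_take; rewrite mem_enum. Qed.

Lemma card_take_set (V : finType) n (S : {set V}) :
  #|take_set n S| = minn n #|S|.
Proof.
rewrite cardsE; have /card_uniqP-> : uniq (take n (enum S)).
  by rewrite take_uniq ?enum_uniq.
by rewrite size_take -cardE.
Qed.

Section Sampling.
Variables (V : finType) (R : realFieldType).

Lemma prod_setUI (q : V -> R) (X Y : {set V}) :
  (\prod_(v in X :|: Y) q v) * \prod_(v in X :&: Y) q v
    = (\prod_(v in X) q v) * \prod_(v in Y) q v.
Proof.
rewrite !(big_mkcond (fun v => v \in _)) -!big_split /=.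
apply: eq_bigr => v _; rewrite !inE.
by case: (v \in X); case: (v \in Y); rewrite ?mulr1 ?mul1r.
Qed.

(** A quadratic minorant of the truncated degree, so that its expectation is controlled by the first
    two moments. Where [c <= x] it amounts to [(x - 2 c)^2 >= 0]. *)
Lemma trunc_ge (x c : nat) : (0 < c)%N ->
  x%:R - x%:R ^+ 2 / (4 * c%:R) <= (minn c x)%:R :> R.
Proof.
move=> c0; have cR : 0 < c%:R :> R by rewrite ltr0n.
rewrite lerBlDr -lerBlDl ler_pdivlMr; last by rewrite mulr_gt0.
rewrite -subr_ge0; case: (leqP c x) => cx.
  have -> : x%:R ^+ 2 - (x%:R - c%:R) * (4 * c%:R)
     = (x%:R - 2 * c%:R) ^+ 2 :> R by ring.
  exact: sqr_ge0.
by rewrite subrr mul0r subr0 sqr_ge0.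
Qed.

(* [a] enters the random graph when all of [N a] was sampled and an independent
   coin of bias [pi a / prod q] succeeds, so it enters with probability [pi a];
   the hypothesis on [c] bounds the expected degree of [b] conditioned on [a]. *)
Lemma sampling (e : rel V) (A B : {set V}) (N : V -> {set V}) (q pi : V -> R)
    (c : nat) (gamma : R) :
  simple_graph e -> [disjoint A & B] ->
  (forall a, a \in A -> N a \subset B) ->
  (forall a b, a \in A -> b \in N a -> e a b) ->
  (forall b, b \in B -> 0 < q b <= 1) ->
  (forall a, a \in A -> 0 <= pi a <= \prod_(b in N a) q b) ->
  (forall a b, a \in A -> b \in N a ->
     1 + \sum_(a' in A | (a' != a) && (b \in N a'))
           pi a' / \prod_(v in N a :&: N a') q v <= c%:R) ->
  (forall a, a \in A -> #|N a| <= c)%N ->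
  (0 < c)%N -> 0 < gamma -> c%:R <= 64 * gamma ->
  gamma * (\sum_(a in A) pi a + \sum_(b in B) q b)
    < 3 / 4 * \sum_(a in A) pi a * #|N a|%:R ->
  has_regular_subgraph e (2 * gamma).
Proof.
move=> [syme irre] dAB NB Ne q01 pi01 cond Nc c0 g0 cg main.
have cR : 0 < c%:R :> R by rewrite ltr0n.
have AB v : v \in A -> v \in B -> False.
  by move=> vA vB; move: dAB => /pred0P/(_ v) /=; rewrite vA vB.
(* A single product measure on all vertices: the coin probability on [A], [q] on [B]. Then [a]
   enters exactly when [a |: N a] lies in the random set. *)
pose w v := if v \in A then pi v / \prod_(b in N v) q b
            else if v \in B then q v else 0.
have qN a : a \in A -> 0 < \prod_(b in N a) q b.
  by move=> aA; apply: prodr_gt0 => b /(subsetP (NB _ aA)) /q01 /andP[].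
have w01 v : 0 <= w v <= 1.
  rewrite /w; case: ifP => vA.
    have /andP[p0 p1] := pi01 _ vA.
    by rewrite ler_pdivrMr ?qN // mul1r p1 andbT divr_ge0 // ltW ?qN.
  by case: ifP => [/q01 /andP[/ltW-> ->]|_] //; rewrite lexx ler01.
have wB (Y : {set V}) : Y \subset B -> \prod_(v in Y) w v = \prod_(v in Y) q v.
  move=> YB; apply: eq_bigr => v /(subsetP YB) vB.
  by rewrite /w vB; case: ifP => // vA; case: (AB v).
have aNN a (Y : {set V}) : a \in A -> Y \subset B -> a \notin Y.
  by move=> aA YB; apply/negP => /(subsetP YB); apply: AB.
have P1 a : a \in A -> \prod_(v in a |: N a) w v = pi a.
  move=> aA; rewrite big_setU1 ?aNN ?NB //= wB ?NB // {1}/w aA divfK //.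
  by rewrite gt_eqF ?qN.
(* Once [a] has entered, [a'] needs only its coin and the neighbours not shared with [a]; hence the
   division by the product over the shared ones. *)
have P2 a a' : a \in A -> a' \in A -> a != a' ->
    \prod_(v in (a |: N a) :|: (a' |: N a')) w v
      = pi a * (pi a' / \prod_(v in N a :&: N a') q v).
  move=> aA a'A naa'.
  have UB : N a :|: N a' \subset B by rewrite subUset !NB.
  have -> : (a |: N a) :|: (a' |: N a') = a |: (a' |: (N a :|: N a')).
    by apply/setP => v; rewrite !inE; case: (v == a); case: (v == a');
       case: (v \in N a); case: (v \in N a').
  rewrite big_setU1 /=; last by rewrite !inE negb_or naa' -in_setU aNN.
  rewrite big_setU1 ?aNN //= wB //.
  have I0 : 0 < \prod_(v in N a :&: N a') q v.
    apply: prodr_gt0 => b; rewrite inE => /andP[ba _].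
    by have /andP[] := q01 _ (subsetP (NB _ aA) _ ba).
  have := prod_setUI q (N a) (N a') => e2.
  have -> : \prod_(v in N a :|: N a') q v =
    (\prod_(v in N a) q v) * (\prod_(v in N a') q v)
      / \prod_(v in N a :&: N a') q v.
    by rewrite -e2 mulfK // gt_eqF.
  rewrite /w aA a'A; field.
  by rewrite !gt_eqF ?qN.
pose A' (X : {set V}) := [set a in A | a |: N a \subset X].
pose d (X : {set V}) b := (\sum_(a in A | b \in N a) ((a |: N a \subset X) : nat))%N.
(* By [trunc_ge], [f X] is at most the number of edges left after truncating degrees in [B] at [c],
   minus [gamma] times the number of vertices. A positive value is the density wanted. *)
pose f (X : {set V}) : R := \sum_(b in B) ((d X b)%:R - (d X b)%:R ^+ 2 / (4 * c%:R))
   - gamma * (#|A' X|%:R + #|B :&: X|%:R).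
have EA : \sum_X subset_weight w X * #|A' X|%:R = \sum_(a in A) pi a.
  rewrite -(eq_bigr _ P1) -sum_subset_weight_nat; apply: eq_bigr => X _.
  congr (_ * _%:R); rewrite -sum1_card big_mkcond [RHS]big_mkcond /=.
  by apply: eq_bigr => a _; rewrite !inE; case: (a \in A); case: (_ \subset _).
have EB : \sum_X subset_weight w X * #|B :&: X|%:R = \sum_(b in B) q b.
  have -> : \sum_(b in B) q b = \sum_(b in B) \prod_(v in [set b]) w v.
    apply: eq_bigr => b bB; rewrite wB ?sub1set // big_set1 //.
  rewrite -sum_subset_weight_nat; apply: eq_bigr => X _.
  congr (_ * _%:R); rewrite -sum1_card big_mkcond [RHS]big_mkcond /=.
  by apply: eq_bigr => b _; rewrite !inE sub1set; case: (b \in B); case: (_ \in _).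
have E1 b : \sum_X subset_weight w X * (d X b)%:R
    = \sum_(a in A | b \in N a) pi a.
  by rewrite /d sum_subset_weight_nat; apply: eq_bigr => a /andP[aA _]; apply: P1.
(* The square is a sum over ordered pairs of entering vertices. For fixed [a], the diagonal term and
   all the others together contribute at most [c * pi a], by [cond]. *)
have E2 b : \sum_X subset_weight w X * (d X b)%:R ^+ 2
    <= c%:R * \sum_(a in A | b \in N a) pi a.
  have -> : \sum_X subset_weight w X * (d X b)%:R ^+ 2 =
    \sum_(a in A | b \in N a) \sum_(a' in A | b \in N a')
       \prod_(v in (a |: N a) :|: (a' |: N a')) w v.
    under [RHS]eq_bigr => a _ do rewrite -sum_subset_weight_nat.
    rewrite exchange_big /=; apply: eq_bigr => X _.
    rewrite -mulr_sumr; congr (_ * _).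
    rewrite expr2 -natrM /d big_distrl /= -natr_sum; congr (_%:R).
    apply: eq_bigr => a _; rewrite big_distrr /=; apply: eq_bigr => a' _.
    by rewrite mulnb -subUset.
  rewrite mulr_sumr; apply: ler_sum => a /andP[aA ba].
  have /andP[p0 _] := pi01 _ aA.
  rewrite (bigD1 a) /=; last by rewrite aA ba.
  rewrite setUid P1 // mulrC; apply: le_trans (ler_wpM2l p0 (cond _ _ aA ba)).
  rewrite mulrDr mulr1 lerD2l mulr_sumr le_eqVlt; apply/orP; left; apply/eqP.
  apply: eq_big => [a'|a' /andP[/andP[a'A ba'] na]].
    by case: (a' \in A); rewrite //= andbC.
  by rewrite P2 // eq_sym.
have sumN : \sum_(b in B) \sum_(a in A | b \in N a) pi a
    = \sum_(a in A) pi a * #|N a|%:R.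
  rewrite (exchange_big_dep (mem A)) /=; last by move=> ? ? _ /andP[].
  apply: eq_bigr => a aA; rewrite mulr_natr -sumr_const.
  apply: eq_bigl => b; rewrite aA /= andbC.
  by case: (boolP (b \in N a)) => //= /(subsetP (NB _ aA)).
have Ef : 0 < \sum_X subset_weight w X * f X.
  have -> : \sum_X subset_weight w X * f X =
    \sum_(b in B) (\sum_X subset_weight w X * (d X b)%:R
       - (\sum_X subset_weight w X * (d X b)%:R ^+ 2) / (4 * c%:R))
    - gamma * (\sum_(a in A) pi a + \sum_(b in B) q b).
    rewrite -EA -EB -big_split /= mulr_sumr.
    rewrite sumrB exchange_big /=.
    under [X in _ - X - _]eq_bigr => b _ do rewrite mulr_suml.
    rewrite [X in _ - X - _]exchange_big /= -!sumrB.
    apply: eq_bigr => X _; rewrite /f sumrB.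
    rewrite mulrBr mulrBr !mulr_sumr; congr (_ - _ - _).
      by apply: eq_bigr => b _; rewrite mulrA.
    by ring.
  rewrite subr_gt0; apply: lt_le_trans main _.
  rewrite -sumN mulr_sumr; apply: ler_sum => b _.
  (* Since the second moment is at most [c] times the first, the quadratic term costs at most a
     quarter of the expectation; this is the [3 / 4] of [main]. *)
  rewrite E1 lerBrDr -lerBrDl ler_pdivrMr; last by rewrite mulr_gt0.
  by apply: le_trans (E2 b) _; rewrite le_eqVlt; apply/orP; left; apply/eqP; field.
have [X fX] : exists X, 0 < f X.
  apply: exists_pos_of_sum Ef => X; exact: subset_weight_ge0.
pose Q b := [set a in A' X | b \in N a].
(* An overfull [b] retains only [c] of its edges, which enforces the maximum degree required by the
   cleaning. *)
pose K b := take_set c (Q b).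
have cK b : #|K b| = minn c #|Q b| := card_take_set c (Q b).
have cQ b : #|Q b| = d X b.
  rewrite -sum1_card /d big_mkcond [RHS]big_mkcond /=.
  apply: eq_bigr => a _; rewrite !inE.
  by case: (a \in A); case: (b \in N a); case: (_ \subset _).
have KP a b : a \in K b -> [/\ a \in A' X, b \in N a, a \in A, b \in B & b \in X].
  move=> /(subsetP (take_set_sub _ _)); rewrite inE => /andP[aA' ba].
  have /andP[aA sX] : (a \in A) && (a |: N a \subset X) by rewrite inE in aA'.
  split=> //.
    exact: (subsetP (NB _ aA) _ ba).
  by apply: (subsetP sX); rewrite !inE ba orbT.
pose F x y := (x \in K y) || (y \in K x).
have symF : symmetric F by move=> x y; rewrite /F orbC.
have degB b : b \in B -> deg F b = #|K b|.
  move=> bB; rewrite /deg; apply: eq_card => a; rewrite inE /F.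
  by case: (boolP (b \in K a)) => // /KP[_ _ bA]; case: (AB b).
have degA a : a \in A -> deg F a = (\sum_(b in B) (a \in K b))%N.
  move=> aA; rewrite degE [RHS]big_mkcond; apply: eq_bigr => b _; rewrite /F.
  have -> : b \in K a = false by apply/negP => /KP[_ _ _ aB]; case: (AB a).
  rewrite orbF; case: ifPn => // bB.
  by apply/eqP; rewrite eqb0; apply: contra bB => /KP[].
have deg0 v : v \notin A -> v \notin B -> deg F v = 0%N.
  move=> vA vB; apply/eqP; rewrite cards_eq0; apply/eqP/setP => u.
  rewrite !inE /F; apply/negP => /orP[] /KP[_ _ uA uB _].
    by rewrite uA in vA.
  by rewrite uB in vB.
have sumdeg : (\sum_v deg F v = 2 * \sum_(b in B) #|K b|)%N.
  have -> : (\sum_v deg F v = \sum_(v in A) deg F v + \sum_(v in B) deg F v)%N.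
    rewrite [X in (_ = X + _)%N]big_mkcond /=.
    rewrite [X in (_ = _ + X)%N]big_mkcond /= -big_split /=.
    apply: eq_bigr => v _; case: (boolP (v \in A)) => vA; case: (boolP (v \in B)) => vB;
      rewrite ?addn0 //; first by case: (AB v).
    by rewrite deg0.
  rewrite (eq_bigr _ degA) (eq_bigr _ degB) exchange_big /= mul2n -addnn.
  congr (_ + _)%N; apply: eq_bigr => b bB.
  rewrite -sum1_card big_mkcond [RHS]big_mkcond; apply: eq_bigr => a _.
  by case: (boolP (a \in K b)) => [/KP[_ _ ->]|_] //=; case: ifP.
have fK : gamma * (#|A' X|%:R + #|B :&: X|%:R) < (\sum_(b in B) #|K b|)%:R.
  move: fX; rewrite /f subr_gt0 => /lt_le_trans; apply.
  rewrite natr_sum; apply: ler_sum => b _; rewrite cK cQ; exact: trunc_ge.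
pose S0 := A' X :|: (B :&: X).
have cS0 : (#|S0| <= #|A' X| + #|B :&: X|)%N by rewrite cardsU leq_subr.
apply: (@min_degree_cleaning _ _ e F S0 c) => //.
- move=> x y /orP[] /KP[_ h1 h2 _ _]; first by apply: Ne.
  by rewrite syme; apply: Ne.
- by move=> x y /orP[] /KP[h1 _ _ h2 h3]; rewrite !inE in h1 *; rewrite h1 h2 h3 !orbT.
- move=> v; case: (boolP (v \in A)) => vA.
    rewrite degA //; apply: leq_trans (Nc _ vA).
    rewrite -sum1_card big_mkcond [leqRHS]big_mkcond; apply: leq_sum => b _.
    case: ifP => // _; case: (boolP (v \in K b)) => [/KP[_ ->]|_] //; by case: ifP.
  case: (boolP (v \in B)) => vB; last by rewrite deg0.
  by rewrite degB // cK geq_minl.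
- by rewrite mulr_gt0.
- by rewrite mulrA -natrM.
- apply/set0Pn; case: (pickP (mem S0)) => [v vS|S00]; first by exists v.
  exfalso; move: fK; rewrite big1 ?ltNge ?mulr_ge0 ?addr_ge0 ?ler0n ?ltW //.
  move=> b bB; apply/eqP; rewrite cards_eq0; apply/eqP/setP => a; rewrite in_set0.
  apply/negP => /KP[aA' _ _ _ _]; have := S00 a.
  by rewrite /= in_setU aA'.
- rewrite sumdeg natrM -mulrA ler_pM2l //.
  apply: le_trans (ltW fK); apply: ler_wpM2l; first exact: ltW.
  by rewrite -natrD ler_nat.
Qed.

End Sampling.

(** * Extremal pairs *)

Section Regularize.
Variables (V : finType) (R : realFieldType).
Implicit Types (e E : rel V) (A B : {set V}).

Lemma has_regular_subgraph_le e (rho rho' : R) : rho' <= rho ->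
  has_regular_subgraph e rho -> has_regular_subgraph e rho'.
Proof.
move=> le [S [F [sub reg avg]]]; exists S, F; split=> //.
by apply: le_trans avg; rewrite ler_wpM2r.
Qed.

Definition ecount E A B := (\sum_(a in A) \sum_(b in B) E a b)%N.

Lemma ecountC E A B : ecount E A B = ecount (fun x y => E y x) B A.
Proof. by rewrite /ecount exchange_big. Qed.

Lemma ecountUl E A A' B : A' \subset A ->
  ecount E A B = (ecount E A' B + ecount E (A :\: A') B)%N.
Proof.
by move=> sA; rewrite /ecount (big_setID A') /= (setIidPr sA).
Qed.

Lemma ecountUr E A B B' : B' \subset B ->
  ecount E A B = (ecount E A B' + ecount E A (B :\: B'))%N.
Proof. by move=> sB; rewrite !(ecountC E); apply: ecountUl. Qed.

Lemma ecount_subl E A A' B : A' \subset A -> (ecount E A' B <= ecount E A B)%N.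
Proof. by move=> sA; rewrite (ecountUl _ _ sA) leq_addr. Qed.

Lemma ecount_gt0 E A B : (0 < ecount E A B)%N -> (0 < #|A|)%N /\ (0 < #|B|)%N.
Proof.
move=> c0; split; rewrite lt0n cards_eq0; apply/eqP => A0; move: c0.
  by rewrite /ecount A0 big_set0.
by rewrite ecountC /ecount A0 big_set0.
Qed.

(** Maximality of [e(A, B)^2 / (|A| |B|)] among subpairs, cross-multiplied so that empty sets need
    no special treatment. *)
Definition extremal_pair E A B := forall A' B', A' \subset A -> B' \subset B ->
  (ecount E A' B' ^ 2 * (#|A| * #|B|) <= ecount E A B ^ 2 * (#|A'| * #|B'|))%N.

Lemma extremal_pairC E A B : extremal_pair E A B ->
  extremal_pair (fun x y => E y x) B A.
Proof.
move=> ext B' A' sB sA; have := ext _ _ sA sB.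
by rewrite -(ecountC E A B) -(ecountC E A' B') (mulnC #|A|) (mulnC #|A'|).
Qed.

(** Let [c'] be the number of edges at the set [A'] of vertices above four times the average degree.
    Then [4 c |A'| <= c' |A|], while extremality gives [c'^2 |A| <= c^2 |A'|]; multiplying yields
    [4 c' <= c]. *)
Lemma extremal_heavy_tail E A B : extremal_pair E A B ->
  (4 * ecount E [set a in A | (4 * ecount E A B < #|A| * \sum_(b in B) E a b)%N] B
     <= ecount E A B)%N.
Proof.
move=> ext; set c := ecount E A B; set A' := [set a in A | _].
have sA : A' \subset A by apply/subsetP => a; rewrite inE => /andP[].
have := ext A' B sA (subxx _); rewrite -/c.
set c' := ecount E A' B => h.
have [->|c'0] := posnP c'; first by rewrite muln0.
have [_ B0] := ecount_gt0 c'0.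
have cc : (c' <= c)%N by apply: ecount_subl.
have h1 : (4 * c * #|A'| <= #|A| * c')%N.
  rewrite mulnC -sum_nat_const [leqRHS]big_distrr /=.
  by apply: leq_sum => a; rewrite inE => /andP[_ /ltnW].
have h2 : (c' ^ 2 * #|A| <= c ^ 2 * #|A'|)%N.
  by rewrite -(@leq_pmul2r #|B|) // -2!mulnA; exact: h.
have c0 : (0 < c)%N by apply: leq_trans cc.
have [A0 _] := ecount_gt0 c0.
have m0 : (0 < c * (c' * #|A|))%N by rewrite !muln_gt0 c0 c'0.
rewrite -(leq_pmul2r m0).
have -> : (4 * c' * (c * (c' * #|A|)) = 4 * c * (c' ^ 2 * #|A|))%N by ring.
apply: leq_trans (leq_mul (leqnn (4 * c)) h2) _.
have -> : (4 * c * (c ^ 2 * #|A'|) = c ^ 2 * (4 * c * #|A'|))%N by ring.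
apply: leq_trans (leq_mul (leqnn (c ^ 2)) h1) _.
by rewrite leq_eqVlt; apply/orP; left; apply/eqP; ring.
Qed.

(** Removing both heavy tails leaves half of the edges. Thinning [A] with probability [|B| / |A|]
    then balances the sides: degrees in [A] are untouched and expected degrees in [B] become
    [O(c / |A|)]. *)
Lemma extremal_pair_regular e E A B :
  simple_graph e -> [disjoint A & B] ->
  (forall a b, a \in A -> b \in B -> E a b -> e a b) ->
  extremal_pair E A B -> (0 < ecount E A B)%N ->
  (#|B| <= #|A|)%N -> (2 * #|A| <= ecount E A B)%N ->
  has_regular_subgraph e ((ecount E A B)%:R / #|A|%:R / 4 : R).
Proof.
move=> se dAB Ee ext c0 BA cA; have [A0 B0] := ecount_gt0 c0.
set c := ecount E A B in c0 cA *.
pose HA := [set a in A | (4 * c < #|A| * \sum_(b in B) E a b)%N].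
pose HB := [set b in B | (4 * c < #|B| * \sum_(a in A) E a b)%N].
have tA : (4 * ecount E HA B <= c)%N := extremal_heavy_tail ext.
have tB : (4 * ecount E A HB <= c)%N.
  have := extremal_heavy_tail (extremal_pairC ext).
  by rewrite -(ecountC E A B) -(ecountC E A HB).
pose A1 := A :\: HA; pose B1 := B :\: HB.
have sHA : HA \subset A by apply/subsetP => a; rewrite inE => /andP[].
have sHB : HB \subset B by apply/subsetP => a; rewrite inE => /andP[].
have sA1 : A1 \subset A by apply: subsetDl.
have sB1 : B1 \subset B by apply: subsetDl.
have cnt1 : (c <= 2 * ecount E A1 B1)%N.
  have e1 : c = (ecount E HA B + ecount E A1 B)%N by apply: ecountUl.
  have e2 : ecount E A1 B = (ecount E A1 HB + ecount E A1 B1)%N by apply: ecountUr.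
  have e3 : (ecount E A1 HB <= ecount E A HB)%N by apply: ecount_subl.
  lia.
pose N a := [set b in B1 | E a b].
have cN a : #|N a| = (\sum_(b in B1) E a b)%N.
  rewrite -sum1_card big_mkcond [RHS]big_mkcond; apply: eq_bigr => b _.
  by rewrite [b \in N a]inE; case: (b \in B1); case: (E a b).
have A0R : 0 < #|A|%:R :> R by rewrite ltr0n.
have B0R : 0 < #|B|%:R :> R by rewrite ltr0n.
have c0R : 0 < c%:R :> R by rewrite ltr0n.
pose al : R := c%:R / #|A|%:R.
have al0 : 0 < al by rewrite divr_gt0.
have al2 : 2 <= al by rewrite ler_pdivlMr // -natrM ler_nat.
pose p : R := #|B|%:R / #|A|%:R.
have p0 : 0 < p by rewrite divr_gt0.
have p1 : p <= 1 by rewrite ler_pdivrMr // mul1r ler_nat.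
(* The floor of [4 * al] plus 2 is at least [4 * al + 1], the extra 1 standing for [a] itself in the
   conditional degree, and it is at most [8 * al], which is 64 times [al / 8]. *)
pose cc := ((4 * c) %/ #|A| + 2)%N.
have cclow : 4 * al + 1 <= cc%:R.
  have : (4 * c <= ((4 * c) %/ #|A| + 1) * #|A|)%N.
    by rewrite addn1; apply: ltnW; apply: ltn_ceil.
  rewrite -(ler_nat R) !natrM -ler_pdivrMr // -/al /cc !natrD /al mulrA.
  lra.
have cchigh : cc%:R <= 8 * al.
  have : (((4 * c) %/ #|A|) * #|A| <= 4 * c)%N by apply: leq_divM.
  rewrite -(ler_nat R) !natrM -ler_pdivlMr // => h.
  rewrite /cc natrD; move: h; rewrite -mulrA -/al; lra.
have -> : c%:R / #|A|%:R / 4 = 2 * (al / 8) by rewrite /al; field; rewrite gt_eqF.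
have degN a : a \in A1 -> (#|N a|%:R <= 4 * al).
  rewrite !inE => /andP[+ aA]; rewrite aA /= -leqNgt => h.
  have : (#|A| * #|N a| <= 4 * c)%N.
    apply: leq_trans h; rewrite leq_mul2l; apply/orP; right.
    rewrite cN [leqLHS]big_mkcond [leqRHS]big_mkcond; apply: leq_sum => b _.
    by case: (boolP (b \in B1)) => // /(subsetP sB1)->.
  by rewrite -(ler_nat R) !natrM mulrC -ler_pdivlMr // mulrA.
apply: (@sampling _ _ e A1 B1 N (fun _ => 1) (fun _ => p) cc) => //.
- apply/pred0P => v /=; apply/negP => /andP[/(subsetP sA1) vA /(subsetP sB1) vB].
  by move: dAB => /pred0P/(_ v) /=; rewrite vA vB.
- by move=> a _; apply/subsetP => b; rewrite inE => /andP[].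
- move=> a b /(subsetP sA1) aA; rewrite inE => /andP[/(subsetP sB1) bB].
  exact: Ee.
- by move=> b _; rewrite ltr01 lexx.
- by move=> a _; rewrite big1 // p1 ltW.
- move=> a b aA1 bN; apply: le_trans cclow; rewrite addrC lerD2r.
  under eq_bigr => a' _ do rewrite big1 // divr1.
  rewrite sumr_const -[p *+ _]mulr_natr; set m := #|_|.
  have bB1 : b \in B1 by move: bN; rewrite inE => /andP[].
  have : (#|B| * \sum_(a in A) E a b <= 4 * c)%N.
    by move: bB1; rewrite !inE => /andP[+ bB]; rewrite bB /= -leqNgt.
  set s := (\sum_(_ in _) _)%N => hs.
  have ms : (m <= s)%N.
    rewrite /m -sum1_card /s big_mkcond [leqRHS]big_mkcond; apply: leq_sum => v _.
    rewrite unfold_in; case: (boolP (v \in A1)) => //= vA1.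
    rewrite (subsetP sA1 _ vA1) [b \in N v]inE.
    by case: (E v b); rewrite ?andbF //; case: ifP.
  move: hs; rewrite -(ler_nat R) !natrM => hs.
  have hms : m%:R <= s%:R :> R by rewrite ler_nat.
  apply: le_trans (ler_wpM2l (ltW p0) hms) _.
  by rewrite /p /al mulrAC ler_pdivrMr // mulrA divfK // gt_eqF.
- by move=> a /degN h; rewrite -(ler_nat R); lra.
- by rewrite /cc addn2.
- by rewrite divr_gt0.
- by apply: le_trans cchigh _; lra.
- have e1 : \sum_(a in A1) p * #|N a|%:R = p * (ecount E A1 B1)%:R.
    by rewrite -mulr_sumr /ecount natr_sum; congr (_ * _); apply: eq_bigr => a _; rewrite cN.
  rewrite e1 !sumr_const.
  have l1 : p *+ #|A1| <= #|B|%:R.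
    rewrite -[p *+ _]mulr_natr /p mulrAC ler_pdivrMr // ler_wpM2l ?ler0n //.
    by rewrite ler_nat subset_leq_card.
  have l2 : 1 *+ #|B1| <= #|B|%:R :> R by rewrite ler_nat subset_leq_card.
  have l3 : c%:R <= 2 * (ecount E A1 B1)%:R :> R by rewrite -natrM ler_nat.
  apply: (@le_lt_trans _ _ (al / 8 * (2 * #|B|%:R))).
    by apply: ler_wpM2l; [rewrite divr_ge0 // ltW | lra].
  apply: (@lt_le_trans _ _ (3 / 8 * (p * c%:R))).
    have -> : al / 8 * (2 * #|B|%:R) = 2 / 8 * (p * c%:R).
      by rewrite /al /p; field; rewrite gt_eqF.
    have : 0 < p * c%:R by rewrite mulr_gt0.
    lra.
  have := ler_wpM2l (ltW p0) l3; lra.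
Qed.

(** A subpair maximising [c^2 / (|A1| |B1|)] keeps this ratio above [4 rho x] and [4 rho y]. As
    [c <= x |A1|] and [c <= y |B1|], the average degree is at least [4 rho] from either side, so
    whichever side is larger can be thinned. *)
Lemma regularize e E A B (x y : nat) (rho : R) :
  simple_graph e -> [disjoint A & B] ->
  (forall a b, a \in A -> b \in B -> E a b -> e a b) ->
  (0 < ecount E A B)%N ->
  (forall a, a \in A -> \sum_(b in B) E a b <= x)%N ->
  (forall b, b \in B -> \sum_(a in A) E a b <= y)%N ->
  1 / 2 <= rho ->
  4 * rho * x%:R * (#|A|%:R * #|B|%:R) <= (ecount E A B)%:R ^+ 2 ->
  4 * rho * y%:R * (#|A|%:R * #|B|%:R) <= (ecount E A B)%:R ^+ 2 ->
  has_regular_subgraph e rho.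
Proof.
move=> se dAB Ee c0 degx degy rho2 hx hy.
pose P (p : {set V} * {set V}) :=
  [&& p.1 \subset A, p.2 \subset B & (0 < ecount E p.1 p.2)%N].
pose ratio (p : {set V} * {set V}) : R :=
  (ecount E p.1 p.2)%:R ^+ 2 / (#|p.1|%:R * #|p.2|%:R).
have PAB : P (A, B) by rewrite /P !subxx c0.
case: (@arg_maxP _ _ _ (A, B) P ratio PAB) => -[A1 B1] /and3P[/= sA sB c1] maxr.
have [A10 B10] := ecount_gt0 c1; have [A0 B0] := ecount_gt0 c0.
have cR n : (0 < n)%N -> 0 < n%:R :> R by rewrite ltr0n.
have ABR : 0 < #|A|%:R * #|B|%:R :> R by rewrite mulr_gt0 ?cR.
have AB1R : 0 < #|A1|%:R * #|B1|%:R :> R by rewrite mulr_gt0 ?cR.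
have ext : extremal_pair E A1 B1.
  move=> A2 B2 sA2 sB2; have [->|c2] := posnP (ecount E A2 B2) => //.
  have [A20 B20] := ecount_gt0 c2.
  have /maxr : P (A2, B2).
    by rewrite /P /= (subset_trans sA2 sA) (subset_trans sB2 sB).
  rewrite /ratio /= => h.
  have AB2R : 0 < #|A2|%:R * #|B2|%:R :> R by rewrite mulr_gt0 ?cR.
  by move: h; rewrite ler_pdivrMr // mulrAC ler_pdivlMr // -!natrX -!natrM ler_nat.
set c := ecount E A1 B1 in c1 maxr *.
have rat z : 4 * rho * z%:R * (#|A|%:R * #|B|%:R) <= (ecount E A B)%:R ^+ 2 ->
    4 * rho * z%:R * (#|A1|%:R * #|B1|%:R) <= c%:R ^+ 2.
  move=> hz; rewrite -ler_pdivlMr //; apply: le_trans (maxr _ PAB).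
  by rewrite /ratio /= ler_pdivlMr.
have c1R := cR _ c1; have A1R := cR _ A10; have B1R := cR _ B10.
have cx : c%:R <= x%:R * #|A1|%:R :> R.
  rewrite -natrM ler_nat mulnC -sum_nat_const; apply: leq_sum => a aA1.
  apply: leq_trans (degx _ (subsetP sA _ aA1)).
  rewrite big_mkcond [leqRHS]big_mkcond; apply: leq_sum => b _.
  by case: (boolP (b \in B1)) => // /(subsetP sB)->.
have cy : c%:R <= y%:R * #|B1|%:R :> R.
  rewrite -natrM ler_nat mulnC -sum_nat_const /c (ecountC E A1 B1); apply: leq_sum => b bB1.
  apply: leq_trans (degy _ (subsetP sB _ bB1)).
  rewrite big_mkcond [leqRHS]big_mkcond; apply: leq_sum => a _.
  by case: (boolP (a \in A1)) => // /(subsetP sA)->.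
have rA : 4 * rho * #|A1|%:R <= c%:R.
  have h0 : 0 <= 4 * rho * #|A1|%:R by rewrite !mulr_ge0 ?ler0n //; lra.
  rewrite -(ler_pM2r c1R); apply: le_trans (ler_wpM2l h0 cy) _.
  by apply: le_trans (rat _ hy); rewrite le_eqVlt; apply/orP; left; apply/eqP; ring.
have rB : 4 * rho * #|B1|%:R <= c%:R.
  have h0 : 0 <= 4 * rho * #|B1|%:R by rewrite !mulr_ge0 ?ler0n //; lra.
  rewrite -(ler_pM2r c1R); apply: le_trans (ler_wpM2l h0 cx) _.
  by apply: le_trans (rat _ hx); rewrite le_eqVlt; apply/orP; left; apply/eqP; ring.
have two z : 0 < z%:R :> R -> 4 * rho * z%:R <= c%:R -> (2 * z <= c)%N.
  move=> z0 h; rewrite -(ler_nat R) natrM; apply: le_trans h.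
  by apply: ler_wpM2r; [exact: ltW | lra].
have d1 : [disjoint A1 & B1].
  apply/pred0P => v /=; apply/negP => /andP[/(subsetP sA) vA /(subsetP sB) vB].
  by move: dAB => /pred0P/(_ v) /=; rewrite vA vB.
have quart z : 0 < z%:R :> R -> 4 * rho * z%:R <= c%:R -> rho <= c%:R / z%:R / 4.
  by move=> z0 h; rewrite ler_pdivlMr // mulrC ler_pdivlMr.
case: (leqP #|B1| #|A1|) => [BA|/ltnW AB].
  apply: has_regular_subgraph_le (quart _ A1R rA) _.
  apply: extremal_pair_regular => //; last exact: two.
  by move=> a b /(subsetP sA) aA /(subsetP sB) bB; apply: Ee.
apply: has_regular_subgraph_le (quart _ B1R rB) _.
rewrite /c (ecountC E A1 B1); apply: extremal_pair_regular => //.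
- by rewrite disjoint_sym.
- case: se => syme _ b a /(subsetP sB) bB /(subsetP sA) aA Eab.
  by rewrite syme; apply: Ee.
- exact: extremal_pairC.
- by rewrite -(ecountC E A1 B1).
- by rewrite -(ecountC E A1 B1); apply: two.
Qed.

End Regularize.

(** * Sets of large codegree *)

(** View [U] as out-neighbourhoods. Some vertex has in-degree at most [k] by averaging; selecting it
    excludes at most [2 k + 1] vertices, itself included, and one repeats. *)
Lemma digraph_independent_set (V : finType) (U : V -> {set V}) (k n : nat)
    (X : {set V}) :
  (forall b, b \in X -> #|U b| <= k)%N -> (n * (2 * k + 1) <= #|X|)%N ->
  exists I : {set V}, [/\ I \subset X, #|I| = n
    & forall b b', b \in I -> b' \in I -> b' != b -> b' \notin U b].
Proof.
elim: n X => [|n IH] X Uk cX.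
  by exists set0; rewrite sub0set cards0; split=> // b b'; rewrite inE.
pose In b := [set b' in X | b \in U b'].
have [b bX Inb] : exists2 b, b \in X & (#|In b| <= k)%N.
  case: (pickP (fun b => (b \in X) && (#|In b| <= k)%N)) => [b /andP[]|no].
    by exists b.
  exfalso.
  have lo : (#|X| * k.+1 <= \sum_(b in X) #|In b|)%N.
    rewrite -sum_nat_const; apply: leq_sum => b bX.
    by have := no b; rewrite bX /= => /negbT; rewrite -ltnNge.
  have hi : (\sum_(b in X) #|In b| <= #|X| * k)%N.
    have -> : (\sum_(b in X) #|In b| = \sum_(b' in X) #|U b' :&: X|)%N.
      under eq_bigr => b _ do rewrite -sum1_card.
      under [RHS]eq_bigr => b _ do rewrite -sum1_card.
      rewrite (exchange_big_dep (mem X)) /=; last by move=> b b' _; rewrite inE => /andP[].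
      apply: eq_bigr => b' b'X; apply: eq_bigl => b.
      by rewrite !inE b'X andbC.
    rewrite -sum_nat_const; apply: leq_sum => b bX.
    by apply: leq_trans (Uk _ bX); rewrite subset_leq_card // subsetIl.
  nia.
pose X' := X :\: (b |: (U b :|: In b)).
have [||I [sI cI indI]] := IH X'.
- by move=> b' /setDP[/Uk].
- have := cardsID (b |: (U b :|: In b)) X; rewrite -/X'.
  have : (#|X :&: (b |: (U b :|: In b))| <= 2 * k + 1)%N.
    apply: leq_trans (subset_leq_card (subsetIr _ _)) _.
    rewrite cardsU1; have := (leq_card_setU (U b) (In b)).1.
    have := Uk _ bX; case: (b \notin _) => /=; lia.
  nia.
have bI : b \notin I.
  by apply/negP => /(subsetP sI); rewrite !inE eqxx.
exists (b |: I); split.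
- rewrite subUset sub1set bX; apply: subset_trans sI _; exact: subsetDl.
- by rewrite cardsU1 bI cI.
move=> x y; rewrite !inE => /orP[/eqP->|xI] /orP[/eqP->|yI].
- by rewrite eqxx.
- by move=> _; have := subsetP sI _ yI; rewrite !inE !negb_or => /andP[/and3P[]].
- move=> _; have := subsetP sI _ xI; rewrite !inE !negb_or => /andP[/and3P[_ _]].
  by rewrite negb_and => /orP[/negP|] // h1 h2; rewrite h2 in h1.
- exact: indI.
Qed.

Lemma expr1D_le (R : realFieldType) (x : R) (n : nat) :
  0 <= x -> 2 * n%:R * x <= 1 -> (1 + x) ^+ n <= 1 + 2 * n%:R * x.
Proof.
move=> x0; elim: n => [|n IH]; first by rewrite expr0 mulr0 mul0r addr0.
rewrite -[n.+1%:R]natr1 => h.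
have n0 : 0 <= n%:R :> R by apply: ler0n.
have h1 : 2 * n%:R * x <= 1 by apply: le_trans h; rewrite mulrDr mulrDl; lra.
rewrite exprSr; apply: le_trans (ler_wpM2r _ (IH h1)) _; first by lra.
by have := ler_wpM2r x0 h1; nra.
Qed.

Section Heavy.
Variable V : finType.
Variables (A : {set V}) (N : V -> {set V}) (k T D Y : nat).

Definition codeg (S : {set V}) := #|[set a in A | S \subset N a]|.

Hypothesis k2 : (1 < k)%N.
Hypothesis NT : forall a, a \in A -> (#|N a| <= T)%N.
Hypothesis kfree : forall S : {set V}, (k <= #|S| -> codeg S < k)%N.
Hypothesis kY : (k <= Y)%N.
Hypothesis YD : (Y ^ (4 * T + 1) <= D)%N.

(** The threshold falls by [Y^4] per element, so that codegrees of the sets that are not heavy stay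
    summable after division by sampling probabilities, which will be at least [Y^-2] per element. *)
Definition heavy b (S : {set V}) :=
  [&& S != set0, b \notin S & (D <= codeg (b |: S) * Y ^ (4 * #|S|))%N].

Let Y0 : (0 < Y)%N. Proof. by apply: leq_trans kY; apply: ltnW. Qed.
Let D0 : (0 < D)%N. Proof. by apply: leq_trans YD; rewrite expn_gt0 Y0. Qed.

(** If [b |: S] had [k] elements its codegree would be below [k <= Y], and heaviness would give
    [D < Y^(4 T + 1)]. *)
Lemma heavy_small b S : heavy b S -> (#|S|.+1 < k)%N.
Proof.
case/and3P=> _ bS hD; rewrite ltnNge; apply/negP => kS.
have cS : #|b |: S| = #|S|.+1 by rewrite cardsU1 bS.
have ck : (codeg (b |: S) < k)%N by apply: kfree; rewrite cS.
have c0 : (0 < codeg (b |: S))%N.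
  by rewrite lt0n; apply/eqP => c0; move: hD; rewrite c0 mul0n leqNgt D0.
have ST : (#|S| <= T)%N.
  move: c0; rewrite card_gt0 => /set0Pn[a]; rewrite inE => /andP[aA sN].
  apply: leq_trans (NT aA); apply: leq_trans (subset_leq_card sN).
  by rewrite cS.
have : (D < Y ^ (4 * T + 1))%N; last by rewrite ltnNge YD.
apply: leq_ltn_trans hD _; rewrite addn1 expnS.
apply: (@leq_ltn_trans (codeg (b |: S) * Y ^ (4 * T))%N).
  by rewrite leq_mul2l leq_pexp2l ?leq_mul2l ?ST ?orbT.
by rewrite ltn_pmul2r ?expn_gt0 ?Y0 //; apply: leq_trans kY.
Qed.

(* Unions of [l] disjoint heavy sets: a maximal one inside [N a] meets every heavy
   subset of [N a], and K_{k,k}-freeness makes it small for most [a]. *)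
Fixpoint heavy_unions b (l : nat) : {set {set V}} :=
  if l is l'.+1 then
    [set p.1 :|: p.2 | p in [set p : {set V} * {set V} |
       [&& heavy b p.1, p.2 \in heavy_unions b l' & [disjoint p.1 & p.2]]]]
  else [set set0].

Lemma heavy_unionsS b l S W : heavy b S -> W \in heavy_unions b l ->
  [disjoint S & W] -> S :|: W \in heavy_unions b l.+1.
Proof.
move=> hS hW dSW; apply/imsetP; exists (S, W) => //.
by rewrite inE /= hS hW.
Qed.

Lemma heavy_unions_notin b l W : W \in heavy_unions b l -> b \notin W.
Proof.
elim: l W => [|l IH] W /=; first by rewrite inE => /eqP->; rewrite inE.
case/imsetP => -[S W'] /=; rewrite inE /= => /and3P[/and3P[_ bS _] /IH bW' _] ->.
by rewrite inE negb_or bS.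
Qed.

Lemma heavy_unions_card b l W : W \in heavy_unions b l -> (l <= #|W|)%N.
Proof.
elim: l W => [|l IH] W //=.
case/imsetP => -[S W'] /=; rewrite inE /= => /and3P[/and3P[S0 _ _] /IH lW' dis] ->.
rewrite cardsU disjoint_setI0 // cards0 subn0.
by move: S0; rewrite -card_gt0; lia.
Qed.

(** From size [k - 1] on, [b |: W] has at least [k] elements and hence codegree below [k]; the cap
    [2 k] keeps the number of such [W] bounded by their total weight. *)
Definition bad a b := [exists l : 'I_k.+1, exists W : {set V},
  [&& W \in heavy_unions b l, W \subset N a, (k <= #|W|.+1)%N & (#|W| <= 2 * k)%N]].

(** A union grows by one heavy set at a time, and such a set has fewer than [k - 1] elements. The
    size therefore cannot jump over the window from [k - 1] to [2 k], where [a] would be bad. *)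
Lemma heavy_unions_small a b l W : ~~ bad a b ->
  W \in heavy_unions b l -> W \subset N a -> (#|W|.+1 < k)%N.
Proof.
move=> nbad; elim: l W => [|l IH] W /=.
  by rewrite inE => /eqP-> _; rewrite cards0.
move=> hW; have := hW; case/imsetP => -[S W'] /=; rewrite inE /= => /and3P[hS hW' dis] eW sW.
have sW' : W' \subset N a by apply: subset_trans sW; rewrite eW subsetUr.
have c1 := IH _ hW' sW'; have c2 := heavy_small hS.
have lk : (l.+1 < k.+1)%N by have := heavy_unions_card hW'; lia.
have cW : (#|W| <= 2 * k)%N.
  rewrite eW; apply: leq_trans (leq_card_setU _ _) _; lia.
rewrite ltnNge; apply/negP => kW; move/negP: nbad; apply.
apply/existsP; exists (Ordinal lk); apply/existsP; exists W.
by apply/and4P; split.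
Qed.

Lemma heavy_hitting_set a b : ~~ bad a b ->
  exists2 U : {set V}, (#|U| <= k)%N &
    forall S, heavy b S -> S \subset N a -> ~~ [disjoint S & U].
Proof.
move=> nbad.
(* Fewer than [k] sets are enough: they are disjoint and non-empty, and their union has fewer than
   [k] elements. *)
pose P (W : {set V}) := (W \subset N a) && [exists l : 'I_k, W \in heavy_unions b l].
have k0 : (0 < k)%N by apply: ltnW.
have P0 : P set0.
  by rewrite /P sub0set /=; apply/existsP; exists (Ordinal k0); rewrite /= inE.
case: (@arg_maxnP _ set0 P (fun W => #|W|) P0) => U /andP[sU /existsP[l hU]] maxU.
exists U; first by have := heavy_unions_small nbad hU sU; lia.
move=> S hS sS; apply/negP => dis.
have hSU := heavy_unionsS hS hU dis.
have sSU : S :|: U \subset N a by rewrite subUset sS.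
have small := heavy_unions_small nbad hSU sSU.
have lk : (l.+1 < k)%N by have := heavy_unions_card hSU; lia.
have /maxU : P (S :|: U).
  by rewrite /P sSU; apply/existsP; exists (Ordinal lk).
rewrite cardsU disjoint_setI0 // cards0 subn0.
by case/and3P: hS; rewrite -card_gt0 => S0 _ _; lia.
Qed.

Variable R : realFieldType.
Hypothesis codegD : forall b, (codeg [set b] <= D * Y)%N.
Hypothesis TY : (2 * T <= Y)%N.

(* With this weight per element the heavy sets, hence by multiplicativity also
   their disjoint unions, have total weight at most [1]. *)
Let y : R := (Y%:R ^+ 7)^-1.
Let YR : 0 < Y%:R :> R. Proof. by rewrite ltr0n. Qed.
Let Y2 : (1 < Y)%N. Proof. by apply: leq_trans kY. Qed.
Let yp : 0 < y. Proof. by rewrite invr_gt0 exprn_gt0. Qed.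

(** Exchange the sums: each neighbour [a] of [b] contributes at most the weight of all non-empty
    subsets of [N a :\ b], which is [(1 + x)^|N a :\ b| - 1], at most [2 n x]. *)
Lemma codeg_weighted_sum b (x : R) (n : nat) (P : pred {set V}) :
  0 <= x -> (forall a, a \in A -> b \in N a -> #|N a :\ b| <= n)%N ->
  2 * n%:R * x <= 1 ->
  (forall S, P S -> S != set0 /\ b \notin S) ->
  \sum_(S | P S) (codeg (b |: S))%:R * x ^+ #|S|
     <= (codeg [set b])%:R * (2 * n%:R * x).
Proof.
move=> x0 Nn nx PS.
have -> : \sum_(S | P S) (codeg (b |: S))%:R * x ^+ #|S| =
   \sum_(a in [set a in A | [set b] \subset N a])
     \sum_(S | P S && (b |: S \subset N a)) x ^+ #|S|.
  rewrite [RHS](exchange_big_dep P) /=; last by move=> a S _ /andP[].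
  apply: eq_bigr => S PS1; rewrite mulr_natl /codeg -sumr_const.
  apply: eq_bigl => a; rewrite !inE PS1 /=; case: (a \in A) => //=.
  by apply/idP/andP => [h|[]//]; split=> //; apply: subset_trans h; rewrite subsetUl.
rewrite mulr_natl /codeg -sumr_const; apply: ler_sum => a.
rewrite inE sub1set => /andP[aA ba].
have cn := Nn _ aA ba.
apply: (@le_trans _ _ (\sum_(S : {set V} | (S \subset N a :\ b) && (S != set0)) x ^+ #|S|)).
  rewrite [leLHS]big_mkcond [leRHS]big_mkcond /=; apply: ler_sum => S _.
  case: ifPn => [/andP[/PS[S0 bS] sN]|_]; last by case: ifP => // _; apply: exprn_ge0.
  rewrite ifT // S0 andbT subsetD1 bS andbT.
  by apply: subset_trans sN; rewrite subsetUr.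
have -> : \sum_(S : {set V} | (S \subset N a :\ b) && (S != set0)) x ^+ #|S|
    = (1 + x) ^+ #|N a :\ b| - 1.
  have := sum_prod_subset (fun _ => x) (N a :\ b).
  rewrite prodr_const => <-; rewrite [X in _ = X - 1](bigD1 set0) ?sub0set //=.
  rewrite big_set0 addrC addrK; apply: eq_bigr => S _; by rewrite prodr_const.
set m := #|N a :\ b| in cn *.
have mn : m%:R <= n%:R :> R by rewrite ler_nat.
have m0 : 0 <= m%:R :> R by apply: ler0n.
have h : 2 * m%:R * x <= 2 * n%:R * x by rewrite ler_wpM2r // ler_wpM2l.
have := expr1D_le x0 (le_trans h nx); lra.
Qed.

(** Heaviness allows [Y^-4] per element to be traded for [codeg / D]. The remaining weight [Y^-3]
    makes the codegree sum at most [D Y] times [2 T Y^-3], hence at most [D]. *)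
Lemma heavy_sum b : \sum_(S | heavy b S) y ^+ #|S| <= 1.
Proof.
pose x : R := (Y%:R ^+ 3)^-1.
have x0 : 0 < x by rewrite invr_gt0 exprn_gt0.
have DR : 0 < D%:R :> R by rewrite ltr0n.
have step : \sum_(S | heavy b S) y ^+ #|S| <=
   (\sum_(S | heavy b S) (codeg (b |: S))%:R * x ^+ #|S|) / D%:R.
  rewrite mulr_suml; apply: ler_sum => S /and3P[_ _ hD].
  rewrite ler_pdivlMr //.
  have -> : y = x * (Y%:R ^+ 4)^-1 by rewrite /y /x -invfM -exprD.
  have -> : (x * (Y%:R ^+ 4)^-1) ^+ #|S| * D%:R =
    x ^+ #|S| * (D%:R / (Y ^ (4 * #|S|))%:R) :> R.
    by rewrite exprMn -mulrA [(_ ^- 4) ^+ _]exprVn -exprM natrX [D%:R * _]mulrC.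
  rewrite [leRHS]mulrC; apply: ler_wpM2l; first by rewrite exprn_ge0 // ltW.
  rewrite ler_pdivrMr ?ltr0n ?expn_gt0 ?Y0 //.
  by rewrite -natrM ler_nat.
apply: le_trans step _; rewrite ler_pdivrMr // mul1r.
have TYR : 2 * T%:R <= Y%:R :> R by rewrite -natrM ler_nat.
have Yx : Y%:R * x = (Y%:R ^+ 2)^-1.
  by rewrite /x (exprS _ 2) invfM mulrA divff ?mul1r // gt_eqF.
have Y1 : 1 <= Y%:R :> R by rewrite ler1n.
have le1 : 2 * T%:R * x <= (Y%:R ^+ 2)^-1.
  by rewrite -Yx ler_wpM2r // ltW.
have le2 : (Y%:R ^+ 2)^-1 <= (Y%:R)^-1 :> R.
  by rewrite lef_pV2 ?posrE ?exprn_gt0 // expr2 ler_peMl // ltW.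
have le3 : (Y%:R)^-1 <= 1 :> R by rewrite invf_le1.
have h := @codeg_weighted_sum b x T (heavy b) (ltW x0).
apply: le_trans (h _ _ _) _.
- move=> a aA _; apply: leq_trans (NT aA).
  by rewrite subset_leq_card // subsetDl.
- by lra.
- by move=> S /and3P[].
have cD : (codeg [set b])%:R <= D%:R * Y%:R :> R by rewrite -natrM ler_nat.
apply: (@le_trans _ _ (D%:R * Y%:R * (Y%:R)^-1)).
  apply: ler_pM; rewrite ?ler0n //; last by lra.
  by rewrite !mulr_ge0 ?ler0n // ltW.
by rewrite mulfK // gt_eqF.
Qed.

Lemma heavy_unions_sum b l : \sum_(W in heavy_unions b l) y ^+ #|W| <= 1.
Proof.
elim: l => [|l IH] /=; first by rewrite big_set1 cards0 expr0.
set P := [set p | _].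
(* A union may arise from several pairs; counting it once per pair only increases the sum. *)
apply: (@le_trans _ _ (\sum_(p in P) y ^+ #|p.1 :|: p.2|)).
  rewrite (partition_big_imset (fun p : {set V} * {set V} => p.1 :|: p.2)) /=.
  apply: ler_sum => W /imsetP[p pP ->].
  rewrite (bigD1 p) /=; last by rewrite pP eqxx.
  by rewrite lerDl sumr_ge0 // => *; rewrite exprn_ge0 // ltW.
apply: (@le_trans _ _ (\sum_(S | heavy b S) \sum_(W in heavy_unions b l) y ^+ #|S| * y ^+ #|W|)).
  rewrite pair_big /= [leLHS]big_mkcond [leRHS]big_mkcond /=.
  apply: ler_sum => -[S W] _; rewrite inE /=.
  case: ifPn => [/and3P[hS hW dSW]|_].
    rewrite hS hW /= cardsU disjoint_setI0 // cards0 subn0 exprD //.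
  by case: ifP => // _; rewrite mulr_ge0 // exprn_ge0 // ltW.
apply: le_trans (heavy_sum b); apply: ler_sum => S _.
by rewrite -mulr_sumr ler_piMr // exprn_ge0 // ltW.
Qed.

(** A witness [W] has at most [2 k] elements, so its weight is at least [Y^(-14 k)] and total weight
    1 leaves at most [Y^(14 k)] witnesses for each [l]. Each one lies with [b] in fewer than [k]
    neighbourhoods. *)
Lemma bad_count b :
  (#|[set a in A | (b \in N a) && bad a b]| <= k.+1 * (k * Y ^ (14 * k)))%N.
Proof.
pose P l := [set W in heavy_unions b l | (k <= #|W|.+1)%N && (#|W| <= 2 * k)%N].
have cP l : (#|P l| <= Y ^ (14 * k))%N.
  rewrite -(ler_nat R) natrX.
  have : (#|P l|)%:R * y ^+ (2 * k) <= 1.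
    apply: le_trans (heavy_unions_sum b l).
    rewrite mulr_natl -sumr_const [leLHS]big_mkcond [leRHS]big_mkcond /=.
    apply: ler_sum => W _; rewrite inE.
    case: ifPn => [/and3P[-> _ W2]|_].
      apply: ler_wiXn2l => //; first exact: ltW.
      by rewrite invf_le1 ?exprn_gt0 // exprn_ege1 // ler1n.
    by case: ifP => // _; rewrite exprn_ge0 // ltW.
  rewrite /y exprVn -exprM ler_pdivrMr ?exprn_gt0 // mul1r.
  by have -> : (7 * (2 * k) = 14 * k)%N by lia.
apply: (@leq_trans (\sum_(l < k.+1) \sum_(W in P l) codeg (b |: W))).
  rewrite -sum1_card.
  have -> : (\sum_(l < k.+1) \sum_(W in P l) codeg (b |: W) =
    \sum_(l < k.+1) \sum_(W in P l) \sum_(a in A | (b |: W) \subset N a) 1)%N.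
    apply: eq_bigr => l _; apply: eq_bigr => W _; rewrite /codeg -sum1_card.
    by apply: eq_bigl => a; rewrite inE.
  have -> : (\sum_(l < k.+1) \sum_(W in P l) \sum_(a in A | (b |: W) \subset N a) 1
    = \sum_(l < k.+1) \sum_(a in A) \sum_(W in P l | (b |: W) \subset N a) 1)%N.
    apply: eq_bigr => l _; rewrite (exchange_big_dep (mem A)) /=; last first.
      by move=> W a _ /andP[].
    by apply: eq_bigr => a aA; apply: eq_bigl => W; rewrite aA.
  rewrite exchange_big /= [leqLHS]big_mkcond [leqRHS]big_mkcond /=.
  apply: leq_sum => a _; rewrite inE; case: (a \in A) => //=.
  case: ifPn => // /andP[ba /existsP[l /existsP[W /and4P[hW sW W1 W2]]]].
  rewrite (bigD1 l) //= (bigD1 W) //=.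
  by rewrite inE hW W1 W2 /= subUset sub1set ba.
apply: (@leq_trans (\sum_(l < k.+1) k * Y ^ (14 * k))).
  apply: leq_sum => l _; apply: (@leq_trans (\sum_(W in P l) k)).
    apply: leq_sum => W; rewrite inE => /and3P[/heavy_unions_notin bW W1 _].
    by apply: ltnW; apply: kfree; rewrite cardsU1 bW.
  by rewrite sum_nat_const mulnC leq_mul2l cP orbT.
by rewrite sum_nat_const card_ord.
Qed.

End Heavy.

(** * Large degrees *)

Section LargeDegrees.
Variables (V : finType) (R : realFieldType).

Lemma sum_card_exchange (A B : {set V}) (M : V -> {set V}) :
  (forall a, a \in A -> M a \subset B) ->
  (\sum_(a in A) #|M a| = \sum_(b in B) #|[set a in A | b \in M a]|)%N.
Proof.
move=> MB; under eq_bigr => a _ do rewrite -sum1_card.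
under [RHS]eq_bigr => a _ do rewrite -sum1_card.
rewrite (exchange_big_dep (mem B)) /=; last by move=> a b /MB /subsetP; apply.
apply: eq_bigr => b bB; apply: eq_bigl => a; by rewrite inE.
Qed.

(** Bad pairs use up at most a quarter of all [T |A|] pairs, so a quarter of the [a] have at least
    [T / 2] good neighbours. Each good [b] has a hitting set [U b] of size at most [k]; in a set
    independent for the digraph [b -> U b], a heavy [S] would contain a point of [U b] other than
    [b], which is impossible. *)
Lemma heavy_free_subsets (A B : {set V}) (N : V -> {set V}) (k T u D Y W : nat) :
  (forall a, a \in A -> N a \subset B) ->
  (forall a, a \in A -> #|N a| = T) ->
  (1 < k)%N -> (u * (4 * k + 2) <= T)%N -> (0 < T)%N ->
  (forall S : {set V}, k <= #|S| -> codeg A N S < k)%N ->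
  (forall b, codeg A N [set b] <= D * Y)%N ->
  (k <= Y)%N -> (2 * T <= Y)%N -> (Y ^ (4 * T + 1) <= D)%N ->
  (4 * (W * (k.+1 * (k * Y ^ (14 * k)))) <= D)%N ->
  (D * #|B| <= W * (T * #|A|))%N ->
  exists (A' : {set V}) (N' : V -> {set V}),
    [/\ A' \subset A, (#|A| <= 4 * #|A'|)%N,
        forall a, a \in A' -> N' a \subset N a,
        forall a, a \in A' -> #|N' a| = u
      & forall a b (S : {set V}), a \in A' -> b \in N' a -> S \subset N' a -> ~~ heavy A N D Y b S].
Proof.
move=> NB NT k2 uT T0 kfree codegD kY TY YD badD DB.
have NT' a : a \in A -> (#|N a| <= T)%N by move=> /NT->.
pose N1 a := [set b in N a | ~~ bad A N k D Y a b].
pose Bad a := [set b in N a | bad A N k D Y a b].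
have N1D a : a \in A -> (#|N1 a| + #|Bad a| = T)%N.
  move=> aA; rewrite -(NT _ aA) -[RHS](cardsID [set b | bad A N k D Y a b]) addnC.
  congr (_ + _)%N; apply: eq_card => b; rewrite !inE //.
  by rewrite andbC.
have sumbad : (4 * \sum_(a in A) #|Bad a| <= T * #|A|)%N.
  have BadB a : a \in A -> Bad a \subset B.
    move=> aA; apply: subset_trans (NB _ aA).
    by apply/subsetP => b; rewrite inE => /andP[].
  rewrite (sum_card_exchange BadB).
  set K := (k.+1 * (k * Y ^ (14 * k)))%N in badD.
  have le1 : (\sum_(b in B) #|[set a in A | b \in Bad a]| <= #|B| * K)%N.
    rewrite -sum_nat_const; apply: leq_sum => b _.
    apply: leq_trans (bad_count k2 NT' kfree kY YD rat codegD TY b).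
    by apply: subset_leq_card; apply/subsetP => a; rewrite !inE.
  have D0 : (0 < D)%N by apply: leq_trans YD; rewrite expn_gt0; apply/orP; left; lia.
  rewrite -(leq_pmul2l D0).
  apply: (@leq_trans (4 * K * (D * #|B|))%N).
    by have := leq_mul (leqnn (4 * D)) le1; lia.
  apply: leq_trans (leq_mul (leqnn (4 * K)) DB) _.
  have -> : (4 * K * (W * (T * #|A|)) = 4 * (W * K) * (T * #|A|))%N by ring.
  by rewrite leq_mul2r badD orbT.
pose A' := [set a in A | (T <= 2 * #|N1 a|)%N].
pose P a (I : {set V}) := [&& I \subset N a, #|I| == u &
  [forall b in I, forall S : {set V}, (S \subset I) ==> ~~ heavy A N D Y b S]].
(* The default is never taken on [A'], where an independent set of good neighbours satisfies [P]. *)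
pose N' a := odflt set0 [pick I | P a I].
have PN' a : a \in A' -> P a (N' a).
  rewrite inE => /andP[aA TN1]; rewrite /N'; case: pickP => //= no; exfalso.
  (* The guard makes the claim hold for every [b], so that [xchoose] yields a function. *)
  have ex b : exists U : {set V}, (b \in N1 a) ==> (#|U| <= k)%N &&
     [forall S : {set V}, heavy A N D Y b S && (S \subset N a) ==> ~~ [disjoint S & U]].
    case: (boolP (b \in N1 a)) => [|_]; last by exists set0.
    rewrite inE => /andP[_ nb].
    have [U Uk hU] := heavy_hitting_set k2 NT' kfree kY YD nb.
    exists U; rewrite Uk /=; apply/forallP => S; apply/implyP => /andP[]; exact: hU.
  pose U b := xchoose (ex b).
  have UP b : b \in N1 a -> (#|U b| <= k)%N /\
     forall S : {set V}, heavy A N D Y b S -> S \subset N a -> ~~ [disjoint S & U b].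
    move=> bN; have /implyP/(_ bN)/andP[Uk /forallP hU] := xchooseP (ex b).
    by split=> // S hS sS; have := hU S; rewrite hS sS.
  have [|I [sI cI indI]] := @digraph_independent_set _ U k u (N1 a) (fun b bN => (UP b bN).1).
    by lia.
  have sIN : I \subset N a.
    by apply: subset_trans sI _; apply/subsetP => b; rewrite inE => /andP[].
  have := no I; rewrite /P sIN cI eqxx /= => /negP; apply.
  apply/forallP => b; apply/implyP => bI; apply/forallP => S; apply/implyP => sS.
  apply/negP => hS; have [_ hU] := UP _ (subsetP sI _ bI).
  have := hU _ hS (subset_trans sS sIN).
  rewrite -setI_eq0 => /set0Pn[b']; rewrite inE => /andP[b'S b'U].
  have b'I := subsetP sS _ b'S.
  have nb : b' != b.
    by apply: contraTneq b'S => ->; case/and3P: hS.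
  by have := indI _ _ bI b'I nb; rewrite b'U.
exists A', N'; split.
- by apply/subsetP => a; rewrite inE => /andP[].
- have s1 : (\sum_(a in A) #|N1 a| + \sum_(a in A) #|Bad a| = T * #|A|)%N.
    by rewrite -big_split /= mulnC -sum_nat_const; apply: eq_bigr => a /N1D.
  have s2 : (2 * \sum_(a in A) #|N1 a| <= 2 * (T * #|A'|) + T * #|A|)%N.
    have -> : (T * #|A'| = \sum_(a in A) (if a \in A' then T else 0))%N.
      rewrite mulnC -sum_nat_const -big_mkcondr /=; apply: eq_bigl => a.
      by rewrite [a \in A']inE; case: (a \in A).
    rewrite [X in (_ + X)%N]mulnC -sum_nat_const !big_distrr -big_split /=.
    apply: leq_sum => a aA; rewrite [a \in A']inE aA /=; have := N1D _ aA.
    by case: (leqP T (2 * #|N1 a|)); lia.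
  rewrite -(leq_pmul2l T0); lia.
- by move=> a /PN' /and3P[].
- by move=> a /PN' /and3P[_ /eqP].
move=> a b S /PN' /and3P[_ _ /forallP h] bN sS.
by have := h b; rewrite bN => /forallP/(_ S); rewrite sS.
Qed.

(** The sampling is applied with [q b] proportional to the degree of [b] and constant [pi], after
    passing to neighbourhoods of size [u] free of heavy sets. Bounding the second moment amounts to
    summing codegrees of subsets of one neighbourhood. *)
Lemma large_degrees (e : rel V) (A B : {set V}) (N : V -> {set V})
    (k T u D Y W : nat) :
  simple_graph e -> [disjoint A & B] ->
  (forall a, a \in A -> N a \subset B) ->
  (forall a b, a \in A -> b \in N a -> e a b) ->
  (forall a, a \in A -> #|N a| = T) ->
  (1 < k)%N -> (0 < u)%N -> (u * (4 * k + 2) <= T)%N ->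
  (forall S : {set V}, k <= #|S| -> codeg A N S < k)%N ->
  (forall b, codeg A N [set b] <= D * Y)%N ->
  (k <= Y)%N -> (0 < W)%N -> (16 * W * T <= Y)%N -> (Y ^ (4 * T + 1) <= D)%N ->
  (4 * (W * (k.+1 * (k * Y ^ (14 * k)))) <= D)%N ->
  (D * #|B| <= W * (T * #|A|))%N -> (0 < #|A|)%N ->
  has_regular_subgraph e (u%:R / 2 : R).
Proof.
move=> se dAB NB Ne NT k2 u0 uT kfree codegD kY W0 ZY YD badD DB A0.
have T0 : (0 < T)%N by nia.
have TY : (2 * T <= Y)%N by nia.
have uT2 : (2 * u <= T)%N by nia.
have Y0 : (0 < Y)%N by lia.
have u2Y : (2 * u <= Y)%N by lia.
have u2T : (2 * u <= 4 * T + 1)%N by lia.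
have D0 : (0 < D)%N by apply: leq_trans YD; rewrite expn_gt0 Y0.
have [A2 [N' [sA2 cA2 sN' cN' light]]] :=
  heavy_free_subsets NB NT k2 uT T0 kfree codegD kY TY YD badD DB.
(* Vertices of [B] of remaining degree below [D / Z] carry at most
   [D |B| / Z <= |A| / 16 <= |A2| / 4] edges, so discarding them costs at most a quarter of the
   [u |A2|] edges. *)
pose Z := (16 * W * T)%N.
pose d' b := #|[set a in A2 | b \in N' a]|.
pose B2 := [set b in B | (D <= d' b * Z)%N].
pose N2 a := N' a :&: B2.
have N'B a : a \in A2 -> N' a \subset B.
  by move=> aA2; apply: subset_trans (sN' _ aA2) (NB _ (subsetP sA2 _ aA2)).
have d'E b : b \in B2 -> #|[set a in A2 | b \in N2 a]| = d' b.
  move=> bB2; rewrite /d'; congr #|pred_of_set _|; apply/setP => a.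
  by rewrite [in LHS]inE [in RHS]inE [b \in N2 a]in_setI bB2 andbT.
have N2B a : a \in A2 -> N2 a \subset B2 by move=> _; rewrite subsetIr.
pose e2 := (\sum_(a in A2) #|N2 a|)%N.
have e2E : e2 = (\sum_(b in B2) d' b)%N.
  by rewrite /e2 (sum_card_exchange N2B); apply: eq_bigr => b /d'E.
have lost : (3 * (u * #|A2|) <= 4 * e2)%N.
  have tot : (u * #|A2| = \sum_(b in B) d' b)%N.
    rewrite -(sum_card_exchange N'B) mulnC -sum_nat_const.
    by apply: eq_bigr => a /cN'.
  have split : (\sum_(b in B) d' b = e2 + \sum_(b in B :\: B2) d' b)%N.
    have sB2 : B2 \subset B by apply/subsetP => b; rewrite inE => /andP[].
    by rewrite e2E (big_setID B2) /= (setIidPr sB2).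
  have small : (Z * \sum_(b in B :\: B2) d' b <= #|B| * D)%N.
    rewrite big_distrr /=; apply: (@leq_trans (\sum_(b in B :\: B2) D)).
      apply: leq_sum => b; rewrite !inE => /andP[+ bB]; rewrite bB /= -ltnNge.
      by rewrite mulnC => /ltnW.
    by rewrite sum_nat_const leq_mul2r subset_leq_card ?subsetDl ?orbT.
  have : (16 * \sum_(b in B :\: B2) d' b <= #|A|)%N.
    have WT0 : (0 < W * T)%N by rewrite muln_gt0 W0.
    rewrite -(leq_pmul2l WT0); move: small DB; rewrite /Z; lia.
  nia.
have A20 : (0 < #|A2|)%N by lia.
have e20 : (0 < e2)%N by nia.
pose M := (D * Y)%N.
have M0 : (0 < M)%N by rewrite muln_gt0 D0.
have nR n : (0 < n)%N -> 0 < n%:R :> R by rewrite ltr0n.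
have MR := nR _ M0; have YR := nR _ Y0; have DR := nR _ D0; have uR := nR _ u0.
have Z0 : (0 < Z)%N by rewrite !muln_gt0 W0 T0.
(* [M = D Y] bounds all degrees, so [q] is at most 1; the cut at [D / Z] and [Z <= Y] make it at
   least [Y^-2] on [B2]. *)
pose q b : R := (d' b)%:R / M%:R.
pose i2 : R := (Y%:R ^+ 2)^-1.
have i20 : 0 < i2 by rewrite invr_gt0 exprn_gt0.
have d'c b : (d' b <= codeg A N [set b])%N.
  apply: subset_leq_card; apply/subsetP => a; rewrite !inE sub1set => /andP[aA2 bN].
  by rewrite (subsetP sA2) // (subsetP (sN' _ aA2)).
have d'0 b : b \in B2 -> (0 < d' b)%N.
  rewrite inE => /andP[_]; case: (d' b) => //; rewrite mul0n leqNgt D0 //.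
have q0 b : b \in B2 -> 0 < q b by move=> bB2; rewrite divr_gt0 // ltr0n d'0.
have q1 b : q b <= 1.
  by rewrite ler_pdivrMr // mul1r ler_nat; apply: leq_trans (d'c b) (codegD b).
have qlow b : b \in B2 -> i2 <= q b.
  rewrite inE => /andP[_ h]; rewrite ler_pdivlMr // /i2 mulrC ler_pdivrMr ?exprn_gt0 //.
  rewrite -natrX -natrM ler_nat /M.
  apply: (@leq_trans (d' b * Z * Y)); first by rewrite leq_mul2r h orbT.
  by rewrite -mulnA leq_mul2l expnS expn1 leq_mul2r ZY !orbT.
have cN2 a : a \in A2 -> (#|N2 a| <= u)%N.
  by move=> aA2; rewrite -(cN' _ aA2) subset_leq_card // subsetIl.
have -> : u%:R / 2 = 2 * (u%:R / 4) :> R by field.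
apply: (@sampling _ _ e A2 B2 N2 q (fun _ => u%:R / M%:R) (2 * u + 1)) => //.
- apply/pred0P => v /=; apply/negP => /andP[/(subsetP sA2) vA]; rewrite inE => /andP[vB _].
  by move: dAB => /pred0P/(_ v) /=; rewrite vA vB.
- move=> a b aA2; rewrite inE => /andP[bN _]; apply: Ne; first exact: (subsetP sA2).
  exact: (subsetP (sN' _ aA2)).
- by move=> b bB2; rewrite q0 ?q1.
- move=> a aA2; rewrite divr_ge0 ?ler0n //=.
  apply: (@le_trans _ _ (\prod_(b in N2 a) i2)); last first.
    apply: ler_prod => b; rewrite inE => /andP[_ bB2]; by rewrite ltW //= qlow.
  rewrite prodr_const /i2 exprVn -exprM ler_pdivrMr // mulrC ler_pdivlMr ?exprn_gt0 //.
  rewrite -natrX -natrM ler_nat mulnC /M.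
  apply: leq_mul; last by apply: leq_trans u2Y; rewrite leq_pmull.
  apply: leq_trans YD; rewrite leq_pexp2l //.
  by apply: leq_trans u2T; rewrite leq_mul2l cN2.
- move=> a b aA2 bN2; have bB2 : b \in B2 by move: bN2; rewrite inE => /andP[].
  have bN' : b \in N' a by move: bN2; rewrite inE => /andP[].
  have dR : 0 < (d' b)%:R :> R by rewrite ltr0n d'0.
  rewrite natrD natrM addrC lerD2r.
  pose S a' := (N2 a :&: N2 a') :\ b.
  (* The factor [q b] turns [u / M] into [u / d' b]; each further common neighbour costs at most
     [Y^2]. It remains to bound the sum by [2 * d' b]. *)
  have step1 : \sum_(a' in A2 | (a' != a) && (b \in N2 a'))
      u%:R / M%:R / \prod_(v in N2 a :&: N2 a') q v <=
    u%:R / (d' b)%:R * \sum_(a' in A2 | b \in N2 a') (Y%:R ^+ 2) ^+ #|S a'|.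
    rewrite mulr_sumr [leLHS]big_mkcond [leRHS]big_mkcond; apply: ler_sum => a' _ /=.
    case: (a' \in A2) => //=; case: (boolP (b \in N2 a')) => bN2'; last by rewrite andbF.
    have t0 : 0 <= u%:R / (d' b)%:R * (Y%:R ^+ 2) ^+ #|S a'| :> R.
      by rewrite mulr_ge0 ?divr_ge0 ?ler0n ?exprn_ge0.
    rewrite andbT; case: ifP => // _.
    rewrite (big_setD1 b) /=; last by rewrite inE bN2.
    rewrite -/(S a').
    have pS : (Y%:R ^+ 2) ^- #|S a'| <= \prod_(v in S a') q v :> R.
      rewrite -exprVn -/i2 -prodr_const; apply: ler_prod => v.
      rewrite !inE => /and3P[_ /andP[_ vB2] _]; rewrite ltW //=.
      by apply: qlow; rewrite inE.
    have pS0 : 0 < \prod_(v in S a') q v.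
      by apply: lt_le_trans pS; rewrite invr_gt0 !exprn_gt0.
    have -> : u%:R / M%:R / (q b * \prod_(v in S a') q v) =
      u%:R / (d' b)%:R * (\prod_(v in S a') q v)^-1.
      rewrite /q; field; rewrite !gt_eqF //.
    apply: ler_wpM2l; first by rewrite divr_ge0 ?ler0n.
    by rewrite -[leRHS]invrK lef_pV2 // posrE // invr_gt0 !exprn_gt0.
  apply: le_trans step1 _.
  rewrite -mulrA [_^-1 * _]mulrC mulrA ler_pdivrMr //.
  rewrite [2 * _]mulrC -mulrA ler_wpM2l ?ler0n //.
  pose Q (X : {set V}) := [&& X != set0, b \notin X & X \subset N' a].
  (* An [a'] with [S a'] empty is counted by [d' b]; any other is charged to the set [X = S a'],
     which together with [b] lies in [N a']. *)
  have step2 : \sum_(a' in A2 | b \in N2 a') (Y%:R ^+ 2) ^+ #|S a'| <=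
    (d' b)%:R + \sum_(X | Q X) (codeg A N (b |: X))%:R * (Y%:R ^+ 2) ^+ #|X| :> R.
    rewrite -(d'E _ bB2) -sum1_card natr_sum.
    have -> : \sum_(X | Q X) (codeg A N (b |: X))%:R * (Y%:R ^+ 2) ^+ #|X| =
      \sum_(X | Q X) \sum_(a' in A | b |: X \subset N a') (Y%:R ^+ 2) ^+ #|X| :> R.
      apply: eq_bigr => X _; rewrite mulr_natl /codeg -sumr_const.
      by apply: eq_bigl => a'; rewrite inE.
    rewrite (exchange_big_dep (mem A)) /=; last by move=> X a' _ /andP[].
    rewrite [X in X + _]big_mkcond [X in _ + X]big_mkcond -big_split /=.
    rewrite [leLHS]big_mkcond; apply: ler_sum => a' _; rewrite inE.
    have nn : 0 <= \sum_(X | Q X && ((a' \in A) && (b |: X \subset N a')))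
       (Y%:R ^+ 2) ^+ #|X| :> R by apply: sumr_ge0 => *; rewrite !exprn_ge0.
    case: ifPn => [/andP[a'A2 bN2']|_]; last first.
      by rewrite add0r; case: ifP.
    have a'A := subsetP sA2 _ a'A2; rewrite a'A /=.
    rewrite a'A /= in nn.
    have [S0|Sn0] := eqVneq (S a') set0.
      by rewrite S0 cards0 expr0 lerDl.
    have sSN' : S a' \subset N' a'.
      by apply/subsetP => v; rewrite !inE => /and3P[_ _ /andP[]].
    have QS : Q (S a') && (b |: S a' \subset N a').
      rewrite /Q Sn0 !inE eqxx /=; apply/andP; split.
        by apply/subsetP => v; rewrite !inE => /and3P[_ /andP[]].
      rewrite subUset sub1set (subset_trans sSN' (sN' _ a'A2)) andbT.
      by apply: (subsetP (sN' _ a'A2)); move: bN2'; rewrite inE => /andP[].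
    rewrite (bigD1 (S a')) //= addrCA lerDl addr_ge0 ?ler01 //.
    by apply: sumr_ge0 => *; rewrite !exprn_ge0.
  apply: le_trans step2 _; rewrite mulr_natl mulr2n lerD2l.
  (* No [X] inside [N' a] is heavy, so the codegree gains [Y^-4] per element against a cost of
     [Y^2]. The resulting sum is at most [D * 2 u / Y^2], below [d' b] because [D <= d' b * Z]. *)
  have step3 : \sum_(X | Q X) (codeg A N (b |: X))%:R * (Y%:R ^+ 2) ^+ #|X| <=
     \sum_(X | Q X) D%:R * i2 ^+ #|X| :> R.
    apply: ler_sum => X /and3P[X0 bX sX].
    have := light _ _ _ aA2 bN' sX; rewrite /heavy X0 bX /= -ltnNge => /ltnW h.
    rewrite /i2 exprVn ler_pdivlMr ?exprn_gt0 // -mulrA -exprD -exprM.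
    have -> : (2 * (#|X| + #|X|) = 4 * #|X|)%N by ring.
    by rewrite -natrX -natrM ler_nat.
  apply: le_trans step3 _; rewrite -mulr_sumr.
  have i2u : 2 * u%:R * i2 <= 1.
    rewrite -natrM /i2 ler_pdivrMr ?exprn_gt0 // mul1r -natrX ler_nat.
    by rewrite expnS expn1; apply: leq_trans u2Y _; rewrite leq_pmull.
  have sumX : \sum_(X | Q X) i2 ^+ #|X| <= 2 * u%:R * i2.
    apply: (@le_trans _ _ ((1 + i2) ^+ u - 1)); last first.
      have := expr1D_le (ltW i20) i2u; lra.
    have := sum_prod_subset (fun _ => i2) (N' a).
    rewrite prodr_const cN' // => <-.
    rewrite [X in _ <= X - 1](bigD1 set0) ?sub0set //=.
    rewrite big_set0 [1 + _]addrC addrK [leLHS]big_mkcond [leRHS]big_mkcond.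
    apply: ler_sum => X _ /=; rewrite /Q prodr_const.
    case: (boolP (X \subset N' a)) => //= _; last by rewrite !andbF.
    rewrite andbT; case: (X != set0) => //=; case: ifP => // _.
    by rewrite exprn_ge0 // ltW.
  apply: le_trans (ler_wpM2l (ltW DR) sumX) _.
  rewrite mulrA /i2 ler_pdivrMr ?exprn_gt0 //.
  rewrite -natrX -!natrM ler_nat.
  have hb : (D <= d' b * Z)%N by move: bB2; rewrite inE => /andP[].
  apply: leq_trans (leq_mul hb (leqnn _)) _.
  rewrite -mulnA leq_mul2l; apply/orP; right.
  rewrite expnS expn1; exact: leq_mul.
- move=> a /cN2 /leq_trans; apply; rewrite mul2n -addnn -addnA; exact: leq_addr.
- by rewrite addn1.
- by rewrite divr_gt0.
- have u1 : 1 <= u%:R :> R by rewrite ler1n.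
  by rewrite natrD natrM; lra.
rewrite -mulr_sumr -natr_sum -/e2 sumr_const.
have -> : \sum_(b in B2) q b = e2%:R / M%:R by rewrite -mulr_suml -natr_sum -e2E.
rewrite -[_ *+ #|A2|]mulr_natr.
have l1 : 3 * (u%:R * #|A2|%:R) <= 4 * e2%:R :> R.
  by rewrite -!natrM ler_nat.
have e2R := nR _ e20.
have -> : u%:R / 4 * (u%:R / M%:R * #|A2|%:R + e2%:R / M%:R) =
  u%:R / M%:R * ((u%:R * #|A2|%:R + e2%:R) / 4) :> R.
  by field; rewrite gt_eqF.
have -> : 3 / 4 * (u%:R / M%:R * e2%:R) = u%:R / M%:R * (3 / 4 * e2%:R) :> R by ring.
rewrite ltr_pM2l ?divr_gt0 //; lra.
Qed.

End LargeDegrees.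

(** * Bipartite reduction and small degrees *)

Section Bipartite.
Variable V : finType.
Implicit Types (e E : rel V) (A B : {set V}).

Lemma pigeonhole_cover (I : finType) (f : V -> nat) B (c : I -> {set V}) :
  (0 < #|I|)%N -> (forall b, b \in B -> exists i, b \in c i) ->
  exists i, (\sum_(b in B) f b <= #|I| * \sum_(b in c i) f b)%N.
Proof.
move=> I0 cov; case: (pickP (fun i => \sum_(b in B) f b <= #|I| * \sum_(b in c i) f b)%N).
  by move=> i hi; exists i.
move=> no; exfalso.
have le1 : (\sum_(b in B) f b <= \sum_i \sum_(b in c i) f b)%N.
  rewrite big_mkcond; under [leqRHS]eq_bigr => i _ do rewrite big_mkcond.
  rewrite exchange_big; apply: leq_sum => b _ /=; case: ifP => // /cov[i bi].
  by rewrite (bigD1 i) //= bi leq_addr.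
have lt1 : (#|I| * \sum_i \sum_(b in c i) f b < #|I| * \sum_(b in B) f b)%N.
  have -> : (#|I| * \sum_(b in B) f b = \sum_(i : I) \sum_(b in B) f b)%N.
    by rewrite sum_nat_const.
  rewrite big_distrr /=.
  have [i0 _] : exists i : I, i \in I by apply/card_gt0P.
  rewrite (bigD1 i0) //= [ltnRHS](bigD1 i0) //= -addSn; apply: leq_add.
    by have := no i0 => /negbT; rewrite -ltnNge.
  by apply: leq_sum => i _; have := no i => /negbT; rewrite -ltnNge => /ltnW.
by move: lt1; rewrite ltn_pmul2l // ltnNge le1.
Qed.

(** For a uniform random [X], an ordered adjacent pair goes from [X] to its complement with
    probability [1/2 - 1/4]. *)
Lemma exists_cut e : irreflexive e ->
  exists X : {set V}, (\sum_x deg e x <= 4 * ecount e X (~: X))%N.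
Proof.
move=> irre.
pose q (_ : V) : rat := 1 / 2.
pose arcs := (\sum_x deg e x)%N.
(* The added 1 makes the expectation strictly positive; integrality removes it at the end. *)
pose f (X : {set V}) : rat := 4 * (ecount e X (~: X))%:R - arcs%:R + 1.
have w1 : \sum_X subset_weight q X = 1.
  have := sum_subset_weight q set0; rewrite big_set0 => <-.
  by apply: eq_bigl => X; rewrite sub0set.
have wE (Y : {set V}) : \sum_X subset_weight q X * (Y \subset X)%:R = (1 / 2) ^+ #|Y|.
  rewrite -prodr_const -[RHS](sum_subset_weight q) [RHS]big_mkcond.
  by apply: eq_bigr => X _; case: (Y \subset X); rewrite ?mulr1 ?mulr0.
have ind (X : {set V}) x y : (x \in X)%:R * (y \in ~: X)%:R
    = ([set x] \subset X)%:R - ([set x; y] \subset X)%:R :> rat.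
  rewrite subUset !sub1set inE.
  by case: (x \in X); case: (y \in X); rewrite ?(mulr1, mulr0, mul0r, subr0, subrr).
have Ee : \sum_X subset_weight q X * (ecount e X (~: X))%:R = arcs%:R / 4.
  have -> : \sum_X subset_weight q X * (ecount e X (~: X))%:R =
    \sum_x \sum_y (e x y)%:R * \sum_X subset_weight q X *
       (([set x] \subset X)%:R - ([set x; y] \subset X)%:R).
    under [RHS]eq_bigr => x _ do under eq_bigr => y _ do rewrite mulr_sumr.
    under [RHS]eq_bigr => x _ do rewrite exchange_big /=.
    rewrite [RHS]exchange_big /=; apply: eq_bigr => X _.
    rewrite /ecount natr_sum mulr_sumr [LHS]big_mkcond; apply: eq_bigr => x _ /=.
    rewrite natr_sum mulr_sumr [in LHS]big_mkcond /=.
    case: ifPn => xX; last first.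
      by rewrite big1 // => y _; rewrite -ind (negbTE xX) mul0r !mulr0.
    apply: eq_bigr => y _; rewrite -ind xX mul1r.
    by case: (y \in ~: X); rewrite ?mulr1 ?mulr0 // mulrC.
  rewrite /arcs natr_sum mulr_suml; apply: eq_bigr => x _.
  rewrite degE natr_sum mulr_suml; apply: eq_bigr => y _.
  have -> : \sum_X subset_weight q X *
       (([set x] \subset X)%:R - ([set x; y] \subset X)%:R) =
     (1 / 2) ^+ #|[set x]| - (1 / 2) ^+ #|[set x; y]|.
    by rewrite -!wE -sumrB; apply: eq_bigr => X _; rewrite mulrBr.
  case: (boolP (e x y)) => exy; last by rewrite !mul0r.
  have nxy : x != y by apply: contraTneq exy => ->; rewrite irre.
  by rewrite cards1 cards2 nxy /=; field.
have [X fX] : exists X, 0 < f X.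
  apply: (@exists_pos_of_sum _ _ (subset_weight q)).
    by move=> X; apply: subset_weight_ge0 => v; rewrite /q; lra.
  have -> : \sum_X subset_weight q X * f X =
     4 * (\sum_X subset_weight q X * (ecount e X (~: X))%:R)
     - (\sum_X subset_weight q X) * (arcs%:R - 1).
    rewrite mulr_sumr mulr_suml -sumrB; apply: eq_bigr => X _; rewrite /f; ring.
  by rewrite Ee w1; lra.
exists X; rewrite -/arcs -ltnS -(ltr_nat rat) -natr1 natrM.
by move: fX; rewrite /f; lra.
Qed.

(** In a smallest subpair of density at least [dl] edges per vertex, deleting a vertex of degree
    below [dl] would preserve the density. *)
Lemma min_degree_pair E A0 B0 (dl : nat) :
  (0 < dl)%N -> (0 < #|A0| + #|B0|)%N ->
  (dl * (#|A0| + #|B0|) <= ecount E A0 B0)%N ->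
  exists A B, [/\ A \subset A0, B \subset B0, (0 < #|A|)%N, (0 < #|B|)%N &
    (forall a, a \in A -> dl <= \sum_(b in B) E a b)%N /\
    (forall b, b \in B -> dl <= \sum_(a in A) E a b)%N].
Proof.
move=> dl0 n0 c0.
pose P (p : {set V} * {set V}) := [&& p.1 \subset A0, p.2 \subset B0,
  (0 < #|p.1| + #|p.2|)%N & (dl * (#|p.1| + #|p.2|) <= ecount E p.1 p.2)%N].
have P0 : P (A0, B0) by rewrite /P /= !subxx n0 c0.
case: (@arg_minnP _ (A0, B0) P (fun p => #|p.1| + #|p.2|)%N P0) => -[A B].
case/and4P=> /= sA sB n1 c1 minAB.
have e0 : (0 < ecount E A B)%N by apply: leq_trans c1; rewrite muln_gt0 dl0.
have [A1 B1] := ecount_gt0 e0.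
exists A, B; split=> //; split.
- move=> a aA; rewrite leqNgt; apply/negP => lt.
  have sa : [set a] \subset A by rewrite sub1set.
  have := ecountUl E B sa; rewrite {2}/ecount big_set1 => eD.
  have cA : #|A :\ a|.+1 = #|A| by rewrite (cardsD1 a A) aA.
  have /minAB /= : P (A :\ a, B).
    rewrite /P /= sB (subset_trans _ sA) ?subsetDl //=.
    by apply/andP; split; [lia | nia].
  lia.
- move=> b bB; rewrite leqNgt; apply/negP => lt.
  have sb : [set b] \subset B by rewrite sub1set.
  have := ecountUr E A sb; rewrite (ecountC E A [set b]) {2}/ecount big_set1 => eD.
  have cB : #|B :\ b|.+1 = #|B| by rewrite (cardsD1 b B) bB.
  have /minAB /= : P (A, B :\ b).
    rewrite /P /= sA (subset_trans _ sB) ?subsetDl //=.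
    by apply/andP; split; [lia | nia].
  lia.
Qed.

Lemma codeg_Kkk_free e A B (N : V -> {set V}) k :
  ~ contains_Kkk e k -> (0 < k)%N -> [disjoint A & B] ->
  (forall a, a \in A -> N a \subset B) ->
  (forall a b, a \in A -> b \in N a -> e a b) ->
  forall S : {set V}, (k <= #|S| -> codeg A N S < k)%N.
Proof.
move=> noK k0 dAB NB Ne S kS; rewrite ltnNge; apply/negP => kc.
apply: noK; pose A' := take_set k [set a in A | S \subset N a].
pose B' := take_set k S.
have cA' : #|A'| = k by rewrite card_take_set (minn_idPl kc).
have cB' : #|B'| = k by rewrite card_take_set (minn_idPl kS).
have sB' : B' \subset S := take_set_sub _ _.
have A'P a : a \in A' -> a \in A /\ S \subset N a.
  by move=> /(subsetP (take_set_sub _ _)); rewrite inE => /andP[].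
have SB : S \subset B.
  have [a aA'] : exists a, a \in A' by apply/set0Pn; rewrite -card_gt0 cA'.
  by have [aA sN] := A'P _ aA'; apply: subset_trans sN (NB _ aA).
exists A', B'; split=> //.
- apply/pred0P => v /=; apply/negP => /andP[/A'P[vA _] /(subsetP sB')/(subsetP SB) vB].
  by move: dAB => /pred0P/(_ v) /=; rewrite vA vB.
- move=> a b /A'P[aA sN] /(subsetP sB') bS; apply: Ne => //.
  exact: (subsetP sN).
Qed.

Variable R : realFieldType.

(** One of the [m] dyadic degree classes of [B] keeps a fraction [1 / m] of the edges. There degrees
    in [B] vary by a factor 2 and degrees in [A] are at most [2 dl], which are the caps passed to
    [regularize]. *)
Lemma dyadic_case e A B (N : V -> {set V}) (dl m : nat) :
  simple_graph e -> [disjoint A & B] ->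
  (forall a b, a \in A -> b \in N a -> e a b) ->
  (forall a, a \in A -> #|N a| <= 2 * dl)%N ->
  (forall b, b \in B -> dl <= #|[set a in A | b \in N a]| < 2 ^ m * dl)%N ->
  (0 < m)%N -> (8 * m <= dl)%N -> (0 < #|A|)%N ->
  (dl * #|A| <= 2 * \sum_(b in B) #|[set a in A | b \in N a]|)%N ->
  has_regular_subgraph e (dl%:R / (16 * m%:R) : R).
Proof.
move=> se dAB Ne Nd dB m0 mdl A0 big.
pose d b := #|[set a in A | b \in N a]|.
have dl0 : (0 < dl)%N by lia.
pose c (i : 'I_m) := [set b in B | (2 ^ i * dl <= d b < 2 ^ i.+1 * dl)%N].
have [|b bB|i hi] := @pigeonhole_cover 'I_m d B c; first by rewrite card_ord.
  have /andP[d1 d2] := dB _ bB.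
  have q0 : (0 < d b %/ dl)%N by rewrite divn_gt0.
  have /andP[t1 t2] := trunc_log_bounds (leqnn 2) q0.
  have tm : (trunc_log 2 (d b %/ dl) < m)%N.
    rewrite -(ltn_exp2l _ _ (leqnn 2)); apply: leq_ltn_trans t1 _.
    by rewrite ltn_divLR.
  exists (Ordinal tm); rewrite inE bB /=; apply/andP; split.
    by rewrite -leq_divRL.
  by rewrite -ltn_divLR.
rewrite card_ord in hi.
set s := (\sum_(b in c i) d b)%N in hi.
have E_s : ecount (fun a b => b \in N a) A (c i) = s.
  rewrite ecountC /ecount /s; apply: eq_bigr => b _; rewrite /d -sum1_card.
  rewrite big_mkcond [RHS]big_mkcond; apply: eq_bigr => a _; rewrite inE.
  by case: (a \in A); case: (b \in N a).
have big' : (dl * #|A| <= 2 * m * s)%N.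
  by rewrite -mulnA; apply: leq_trans big _; rewrite leq_mul2l hi orbT.
have s0 : (0 < s)%N.
  have dA0 : (0 < dl * #|A|)%N by rewrite muln_gt0 dl0.
  by move: (leq_trans dA0 big'); rewrite muln_gt0 => /andP[].
have clow : (2 ^ i * dl * #|c i| <= s)%N.
  rewrite mulnC -sum_nat_const; apply: leq_sum => b; rewrite inE => /andP[_ /andP[]//].
have mR : 0 < m%:R :> R by rewrite ltr0n.
have sR : 0 < s%:R :> R by rewrite ltr0n.
pose rho : R := dl%:R / (16 * m%:R).
have rho0 : 0 < rho by rewrite divr_gt0 ?mulr_gt0 ?ltr0n.
have rhoA : 8 * rho * #|A|%:R <= s%:R.
  have -> : 8 * rho * #|A|%:R = dl%:R * #|A|%:R / (2 * m%:R).
    by rewrite /rho; field; rewrite gt_eqF.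
  rewrite ler_pdivrMr ?mulr_gt0 // -!natrM ler_nat.
  by rewrite [leqRHS]mulnC.
have key z : z%:R * #|c i|%:R <= 2 * s%:R :> R ->
   4 * rho * z%:R * (#|A|%:R * #|c i|%:R) <= s%:R ^+ 2 :> R.
  move=> hz.
  have -> : 4 * rho * z%:R * (#|A|%:R * #|c i|%:R) =
     (4 * rho * #|A|%:R) * (z%:R * #|c i|%:R) by ring.
  have h0 : 0 <= 4 * rho * #|A|%:R.
    by apply: mulr_ge0 => //; apply: mulr_ge0 => //; apply: ltW.
  apply: le_trans (ler_wpM2l h0 hz) _.
  have -> : 4 * rho * #|A|%:R * (2 * s%:R) = 8 * rho * #|A|%:R * s%:R by ring.
  by rewrite expr2 ler_pM2r.
apply: (@regularize _ _ e (fun a b => b \in N a) A (c i) (2 * dl) (2 ^ i.+1 * dl)) => //.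
- apply/pred0P => v /=; apply/negP => /andP[vA]; rewrite inE => /andP[vB _].
  by move: dAB => /pred0P/(_ v) /=; rewrite vA vB.
- by move=> a b aA _; apply: Ne.
- by rewrite E_s.
- move=> a aA; apply: leq_trans (Nd _ aA); rewrite -sum1_card.
  rewrite big_mkcond [leqRHS]big_mkcond; apply: leq_sum => b _.
  by case: ifP => // _; case: (b \in N a).
- move=> b; rewrite inE => /and3P[_ _ /ltnW db]; apply: leq_trans db.
  rewrite /d -sum1_card big_mkcond [leqRHS]big_mkcond; apply: leq_sum => a _.
  by rewrite inE; case: (a \in A); case: (b \in N a).
- rewrite ler_pdivlMr ?mulr_gt0 //.
  have : 8 * m%:R <= dl%:R :> R by rewrite -natrM ler_nat.
  lra.
- rewrite E_s; apply: key; rewrite -!natrM ler_nat -mulnA leq_mul2l.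
  apply: leq_trans clow; rewrite leq_mul2r; apply/orP; right.
  by rewrite leq_pmull // expn_gt0.
- rewrite E_s; apply: key; rewrite -!natrM ler_nat expnS -!mulnA leq_mul2l.
  by rewrite mulnA clow.
Qed.

End Bipartite.

(** * Degree windows *)

Section Windows.
Variable V : finType.

(** These are the size conditions of [large_degrees] for [Y = 2^g], [D = 2^(g (r + s))] and
    [W = 20 r^2 Lc]. With [P = 2^lr], polynomial factors are absorbed through [r <= P^2] and
    [Lc P^18 <= 2^g]. *)
Lemma window_numerics (k r Lc lr g s T : nat) :
  (0 < Lc)%N -> (9 <= lr)%N -> (r < 2 ^ lr.+1)%N -> (k.+1 <= r)%N ->
  (14 * k + 1 <= r)%N -> (8 * T <= r)%N -> (0 < T)%N -> (20 * Lc * lr <= g)%N ->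
  [/\ (k <= 2 ^ g)%N, (16 * (20 * r ^ 2 * Lc) * T <= 2 ^ g)%N,
      ((2 ^ g) ^ (4 * T + 1) <= 2 ^ (g * (r + s)))%N
    & (4 * ((20 * r ^ 2 * Lc) * (k.+1 * (k * (2 ^ g) ^ (14 * k))))
        <= 2 ^ (g * (r + s)))%N].
Proof.
move=> Lc0 lr9 rlr kr k14 T8 T0 gl.
pose P := (2 ^ lr)%N.
have P512 : (512 <= P)%N by rewrite (_ : 512 = 2 ^ 9)%N // leq_exp2l.
have rP : (r <= P * P)%N by move: rlr; rewrite expnS -/P; nia.
have LcY : (Lc * P ^ 18 <= 2 ^ g)%N.
  apply: (@leq_trans (2 ^ (Lc + lr * 18))).
    by rewrite expnD expnM leq_mul2r; apply/orP; right; apply: ltnW; apply: ltn_expl.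
  by rewrite leq_exp2l //; apply: leq_trans gl; nia.
have P0 : (0 < P)%N by apply: leq_trans P512.
have P1 n : (n <= 18 -> Lc * P ^ n <= 2 ^ g)%N.
  by move=> n18; apply: leq_trans LcY; rewrite leq_mul2l leq_pexp2l ?orbT.
have c1 : (320 <= P * P)%N by nia.
have Tr : (T <= P * P)%N by lia.
split.
- apply: leq_trans (P1 2 isT); rewrite expnS expn1; nia.
- apply: leq_trans (P1 8 isT).
  have -> : (16 * (20 * r ^ 2 * Lc) * T = Lc * (320 * (r * (r * T))))%N by ring.
  have -> : (Lc * P ^ 8 = Lc * ((P * P) * ((P * P) * ((P * P) * (P * P)))))%N by ring.
  by rewrite leq_mul2l; apply/orP; right; do 3?apply: leq_mul.
- rewrite -expnM leq_exp2l // leq_mul2l; apply/orP; right; lia.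
have c2 : (4 * (20 * r ^ 2 * Lc) * (k.+1 * k) <= 2 ^ g)%N.
  apply: leq_trans (P1 10 isT).
  have -> : (4 * (20 * r ^ 2 * Lc) * (k.+1 * k) = Lc * (80 * (r * (r * (k.+1 * k)))))%N by ring.
  have -> : (Lc * P ^ 10 = Lc * ((P * P) * ((P * P) * ((P * P) * ((P * P) * (P * P))))))%N by ring.
  rewrite leq_mul2l; apply/orP; right; do 4?apply: leq_mul => //; lia.
have -> : (4 * ((20 * r ^ 2 * Lc) * (k.+1 * (k * (2 ^ g) ^ (14 * k)))) =
   4 * (20 * r ^ 2 * Lc) * (k.+1 * k) * (2 ^ g) ^ (14 * k))%N.
  by rewrite !mulnA.
apply: leq_trans (leq_mul c2 (leqnn _)) _.
rewrite -expnS -expnM leq_exp2l // leq_mul2l; apply/orP; right; lia.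
Qed.

(* With [g = 2^i m], [D = 2^(g (r + s))] and [Y = 2^g], the window is [[D, D Y)]
   where [Y^r <= D]; the exponents [log2 d] are cut into doubling blocks [i] of [r]
   equal pieces [s]. *)
Lemma window_cover (r Lc m d : nat) :
  (0 < r)%N -> (1 < m)%N -> (2 ^ (m * r) <= d)%N -> (d <= 2 ^ (2 ^ Lc))%N ->
  exists (i : 'I_Lc) (s : 'I_r),
    (2 ^ (2 ^ i * m * (r + s)) <= d < 2 ^ (2 ^ i * m * (r + s) + 2 ^ i * m))%N.
Proof.
move=> r0 m1 dlo dhi.
have d0 : (0 < d)%N by apply: leq_trans dlo; rewrite expn_gt0.
have /andP[l1 l2] := trunc_log_bounds (leqnn 2) d0; set l := trunc_log 2 d in l1 l2.
have lmr : (m * r <= l)%N.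
  by rewrite -ltnS -(ltn_exp2l _ _ (leqnn 2)); apply: leq_ltn_trans dlo l2.
have lL : (l <= 2 ^ Lc)%N by rewrite -(leq_exp2l _ _ (leqnn 2)); apply: leq_trans l1 dhi.
have mr0 : (0 < m * r)%N by rewrite muln_gt0 r0 andbT ltnW.
have q0 : (0 < l %/ (m * r))%N by rewrite divn_gt0.
have /andP[i1 i2] := trunc_log_bounds (leqnn 2) q0.
set i := trunc_log 2 _ in i1 i2.
rewrite leq_divRL // in i1; rewrite ltn_divLR // in i2.
have iL : (i < Lc)%N.
  rewrite -(ltn_exp2l _ _ (leqnn 2)); apply: leq_trans lL; apply: leq_trans i1.
  by rewrite -[ltnLHS]muln1 ltn_pmul2l ?expn_gt0 //; nia.
pose g := (2 ^ i * m)%N.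
have g0 : (0 < g)%N by rewrite muln_gt0 expn_gt0 /= ltnW.
have lr1 : (r <= l %/ g)%N by rewrite leq_divRL //; move: i1; rewrite /g; nia.
have lr2 : (l %/ g < r + r)%N.
  rewrite ltn_divLR //; apply: leq_trans i2 _; rewrite /g expnS.
  by rewrite leq_eqVlt; apply/orP; left; apply/eqP; ring.
have sr : (l %/ g - r < r)%N by lia.
exists (Ordinal iL), (Ordinal sr); rewrite /= -/g subnKC //.
apply/andP; split.
  by apply: leq_trans l1; rewrite leq_exp2l // mulnC leq_divM.
apply: leq_trans l2 _; rewrite leq_exp2l // addnC -mulnS mulnC.
exact: ltn_ceil.
Qed.

(** Compares [r] with [u] after rounding down [r / 8] to [T] and [T / (4 k + 2)] to [u]; positivity
    of [u] gives [u + 1 <= 2 u]. *)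
Lemma window_rate (k r lr T u : nat) :
  (r < 8 * T.+1)%N -> (T < u.+1 * (4 * k + 2))%N -> (0 < u)%N -> (9 <= lr)%N ->
  (r <= 80 * (k + 1) * lr * u)%N.
Proof.
move=> rT Tu u0 lr9.
apply: (@leq_trans (16 * u * (4 * k + 2))).
  apply: (@leq_trans (8 * (u.+1 * (4 * k + 2)))); first by lia.
  by rewrite mulnA leq_mul2r; apply/orP; right; lia.
have -> : (16 * u * (4 * k + 2) = (64 * k + 32) * u)%N by ring.
rewrite leq_mul2r; apply/orP; right.
by apply: (@leq_trans (80 * (k + 1) * 1)); [lia | rewrite leq_mul2l; lia].
Qed.

Variable R : realFieldType.

Lemma window_case (e : rel V) (A B : {set V}) (N : V -> {set V}) (k r Lc lr : nat) :
  simple_graph e -> ~ contains_Kkk e k -> [disjoint A & B] ->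
  (forall a, a \in A -> N a \subset B) ->
  (forall a b, a \in A -> b \in N a -> e a b) ->
  (forall a, a \in A -> #|N a| <= 10 * r ^ 2 * Lc)%N ->
  (forall b, b \in B ->
     2 ^ (20 * Lc * lr * r) <= #|[set a in A | b \in N a]| <= 2 ^ (2 ^ Lc))%N ->
  (10 * r ^ 2 * Lc * #|A| <= 4 * \sum_(b in B) #|[set a in A | b \in N a]|)%N ->
  (1 < k)%N -> (0 < Lc)%N -> (9 <= lr)%N -> (r < 2 ^ lr.+1)%N ->
  (160 * (k + 1) * lr <= r)%N -> (0 < #|A|)%N ->
  has_regular_subgraph e (r%:R / (160 * (k + 1)%:R * lr%:R) : R).
Proof.
move=> se noK dAB NB Ne Nd dB big k2 Lc0 lr9 rlr rk A0.
pose d b := #|[set a in A | b \in N a]|.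
pose m := (20 * Lc * lr)%N.
have kr : (1440 * (k + 1) <= r)%N by apply: leq_trans rk; nia.
have r0 : (0 < r)%N by lia.
pose c (p : 'I_Lc * 'I_r) := [set b in B |
  (2 ^ (2 ^ p.1 * m * (r + p.2)) <= d b < 2 ^ (2 ^ p.1 * m * (r + p.2) + 2 ^ p.1 * m))%N].
have [|b bB|[i s] hi] := @pigeonhole_cover V _ d B c.
- by rewrite card_prod !card_ord muln_gt0 Lc0.
- have /andP[d1 d2] := dB _ bB.
  have [|i [s h]] := @window_cover r Lc m (d b) r0 _ d1 d2; first by rewrite /m; nia.
  by exists (i, s); rewrite inE bB.
rewrite card_prod !card_ord in hi; set Bj := c (i, s) in hi.
pose g := (2 ^ i * m)%N; pose D := (2 ^ (g * (r + s)))%N; pose Y := (2 ^ g)%N.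
have BjP b : b \in Bj -> [/\ b \in B, (D <= d b)%N & (d b <= D * Y)%N].
  by rewrite inE /= => /and3P[-> h1 /ltnW]; rewrite expnD; split.
pose T := (r %/ 8)%N.
have T8 : (8 * T <= r)%N by rewrite mulnC leq_divM.
have T8' : (r < 8 * T.+1)%N by rewrite mulnC; apply: ltn_ceil.
set ej := (\sum_(b in Bj) d b)%N in hi.
have ej1 : (2 * T * #|A| <= ej)%N.
  have : (10 * r * #|A| <= 4 * ej)%N.
    have rl0 : (0 < r * Lc)%N by rewrite muln_gt0 r0.
    rewrite -(leq_pmul2l rl0).
    have -> : (r * Lc * (10 * r * #|A|) = 10 * r ^ 2 * Lc * #|A|)%N by ring.
    apply: leq_trans big _.
    have -> : (r * Lc * (4 * ej) = 4 * (Lc * r * ej))%N by ring.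
    by rewrite leq_mul2l hi orbT.
  nia.
pose Nj a := N a :&: Bj.
have NjB a : a \in A -> Nj a \subset Bj by move=> _; rewrite subsetIr.
have sumNj : (\sum_(a in A) #|Nj a| = ej)%N.
  rewrite (sum_card_exchange NjB); apply: eq_bigr => b bBj.
  congr #|pred_of_set _|; apply/setP => a.
  by rewrite [in LHS]inE [in RHS]inE [b \in Nj a]in_setI bBj andbT.
pose Aj := [set a in A | (T <= #|Nj a|)%N].
have sAj : Aj \subset A by apply/subsetP => a; rewrite inE => /andP[].
have ejA : (ej <= 10 * r ^ 2 * Lc * #|Aj| + T * #|A|)%N.
  rewrite -sumNj [X in (X + _)%N]mulnC [X in (_ + X)%N]mulnC -!sum_nat_const.
  rewrite big_mkcond [X in (X + _)%N]big_mkcond [X in (_ + X)%N]big_mkcond -big_split /=.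
  apply: leq_sum => a _; rewrite [a \in Aj]inE; case: (boolP (a \in A)) => //= aA.
  case: (leqP T #|Nj a|) => [_|/ltnW//]; apply: leq_trans (leq_addr _ _).
  by apply: leq_trans (Nd _ aA); rewrite subset_leq_card // subsetIl.
(* Vertices of degree below [T] carry at most [T |A| <= ej / 2] edges; the others have degree at
   most [10 r^2 Lc]. Doubling explains the value of [W] below. *)
have ej2 : (ej <= 20 * r ^ 2 * Lc * #|Aj|)%N by lia.
have T0 : (0 < T)%N by lia.
have Aj0 : (0 < #|Aj|)%N.
  have h : (0 < 2 * T * #|A|)%N by rewrite !muln_gt0 T0 A0.
  by move: (leq_trans h (leq_trans ej1 ej2)); rewrite muln_gt0 => /andP[].
pose Nt a := take_set T (Nj a).
have NtNj a : Nt a \subset Nj a := take_set_sub _ _.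
have NtBj a : Nt a \subset Bj by apply: subset_trans (NtNj a) _; rewrite subsetIr.
have NtN a : Nt a \subset N a by apply: subset_trans (NtNj a) _; rewrite subsetIl.
have dAjBj : [disjoint Aj & Bj].
  apply/pred0P => v /=; apply/negP => /andP[/(subsetP sAj) vA /BjP[vB _ _]].
  by move: dAB => /pred0P/(_ v) /=; rewrite vA vB.
pose u := (T %/ (4 * k + 2))%N.
have uT : (u * (4 * k + 2) <= T)%N by apply: leq_divM.
have uT' : (T < (u.+1) * (4 * k + 2))%N by apply: ltn_ceil; rewrite addn2.
have u0 : (0 < u)%N by rewrite divn_gt0 ?addn2 //; lia.
have gm : (20 * Lc * lr <= g)%N by rewrite /g -/m leq_pmull // expn_gt0.
have [||n1 n2 n3 n4] := @window_numerics k r Lc lr g s T Lc0 lr9 rlr _ _ T8 T0 gm.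
- lia.
- lia.
have ub := window_rate T8' uT' u0 lr9.
apply: (@has_regular_subgraph_le V R e (u%:R / 2)).
  have ck0 : 0 < (k + 1)%:R :> R by rewrite ltr0n addn1.
  have lr0 : 0 < lr%:R :> R by rewrite ltr0n; apply: leq_trans lr9.
  rewrite ler_pdivrMr ?mulr_gt0 // -(ler_nat R) in ub *.
  by move: ub; rewrite !natrM; lra.
apply: (@large_degrees V R e Aj Bj Nt k T u D Y (20 * r ^ 2 * Lc)) => //.
- by move=> a b /(subsetP sAj) aA /(subsetP (NtN a)); apply: Ne.
- by move=> a; rewrite inE => /andP[_ h]; rewrite card_take_set (minn_idPl h).
- apply: (codeg_Kkk_free noK _ dAjBj) => //; first exact: ltnW.
  by move=> a b /(subsetP sAj) aA /(subsetP (NtN a)); apply: Ne.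
- move=> b; case: (boolP (b \in Bj)) => bBj.
    have [_ _ h] := BjP _ bBj; apply: leq_trans h; apply: subset_leq_card.
    apply/subsetP => a; rewrite inE sub1set => /andP[/(subsetP sAj) aA bN].
    by rewrite inE aA (subsetP (NtN a)).
  rewrite /codeg (_ : [set a in Aj | _] = set0) ?cards0 //.
  apply/setP => a; rewrite in_set0 inE sub1set; apply/negP => /andP[_ /(subsetP (NtBj a))].
  by apply/negP.
- by rewrite !muln_gt0 r0.
- apply: (@leq_trans ej).
    by rewrite mulnC -sum_nat_const; apply: leq_sum => b /BjP[].
  apply: leq_trans ej2 _; rewrite leq_mul2l; apply/orP; right.
  by rewrite leq_pmull.
Qed.

(** With all degrees in [A] cut to [2 dl], the vertices of [B] of degree below [dl] carry at most
    [dl |B| <= dl |A|] edges, half of the total. Of the rest, half lies either in the [m] dyadic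
    classes above [dl] or beyond them. *)
Lemma bipartite_case (e : rel V) (A B : {set V}) (k r Lc lr : nat) :
  simple_graph e -> ~ contains_Kkk e k -> [disjoint A & B] ->
  (forall x, deg e x <= 2 ^ (2 ^ Lc))%N ->
  (0 < #|A|)%N -> (#|B| <= #|A|)%N ->
  (forall a, a \in A -> 10 * r ^ 2 * Lc <= \sum_(b in B) e a b)%N ->
  (1 < k)%N -> (0 < Lc)%N -> (9 <= lr)%N -> (r < 2 ^ lr.+1)%N ->
  (160 * (k + 1) * lr <= r)%N ->
  has_regular_subgraph e (r%:R / (160 * (k + 1)%:R * lr%:R) : R).
Proof.
move=> se noK dAB degL A0 BA degA k2 Lc0 lr9 rlr rk.
pose N a := take_set (10 * r ^ 2 * Lc) [set b in B | e a b].
have NB a : N a \subset B.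
  apply: subset_trans (take_set_sub _ _) _.
  by apply/subsetP => b; rewrite inE => /andP[].
have Ne a b : b \in N a -> e a b.
  by move=> /(subsetP (take_set_sub _ _)); rewrite inE => /andP[].
have Nd a : a \in A -> #|N a| = (10 * r ^ 2 * Lc)%N.
  move=> aA; rewrite card_take_set; apply/minn_idPl; apply: leq_trans (degA _ aA) _.
  rewrite -sum1_card big_mkcond [leqRHS]big_mkcond; apply: leq_sum => b _.
  by rewrite inE; case: (b \in B); case: (e a b).
pose d b := #|[set a in A | b \in N a]|.
pose dl := (5 * r ^ 2 * Lc)%N.
pose m := (20 * Lc * lr * r)%N.
pose Bs := [set b in B | (dl <= d b < 2 ^ m * dl)%N].
pose Bl := [set b in B | (2 ^ m * dl <= d b)%N].
have r0 : (0 < r)%N by nia.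
have dl0 : (0 < dl)%N by rewrite !muln_gt0 r0.
have sumB : (\sum_(b in B) d b = 2 * dl * #|A|)%N.
  rewrite -(sum_card_exchange (fun a (_ : a \in A) => NB a)) (eq_bigr _ Nd).
  by rewrite sum_nat_const /dl; ring.
have sumB2 : (\sum_(b in B) d b <=
    \sum_(b in Bs) d b + \sum_(b in Bl) d b + dl * #|B|)%N.
  rewrite [X in (_ + X)%N]mulnC -sum_nat_const big_mkcond.
  rewrite [X in (X + _ + _)%N]big_mkcond [X in (_ + X + _)%N]big_mkcond.
  rewrite [X in (_ + X)%N]big_mkcond -!big_split /=; apply: leq_sum => b _.
  rewrite !inE; case: (b \in B) => //=.
  by case: (leqP dl (d b)); case: (ltnP (d b) (2 ^ m * dl)) => /=; lia.
have sumsl : (dl * #|A| <= \sum_(b in Bs) d b + \sum_(b in Bl) d b)%N.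
  have := leq_mul (leqnn dl) BA; lia.
have lr0 : 0 < lr%:R :> R by rewrite ltr0n; apply: leq_trans lr9.
have ck0 : 0 < (k + 1)%:R :> R by rewrite ltr0n addn1.
have rR : 0 < r%:R :> R by rewrite ltr0n.
have LR : 0 < Lc%:R :> R by rewrite ltr0n.
case: (leqP (dl * #|A|) (2 * \sum_(b in Bs) d b)) => [small|large].
  apply: (@has_regular_subgraph_le V R e (dl%:R / (16 * m%:R))).
    have -> : dl%:R / (16 * m%:R) = r%:R / (64 * lr%:R) :> R.
      rewrite /dl /m !natrM; field.
      by rewrite !gt_eqF.
    rewrite ler_pM2l // lef_pV2 ?posrE ?mulr_gt0 // ler_pM2r //.
    have : 1 <= (k + 1)%:R :> R by rewrite ler1n addn1.
    lra.
  apply: (@dyadic_case V R e A Bs N dl m) => //.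
  - apply/pred0P => v /=; apply/negP => /andP[vA]; rewrite inE => /andP[vB _].
    by move: dAB => /pred0P/(_ v) /=; rewrite vA vB.
  - by move=> a b _; apply: Ne.
  - by move=> a /Nd->; rewrite /dl; lia.
  - by move=> b; rewrite inE => /andP[].
  - by rewrite !muln_gt0 r0 Lc0 (leq_trans _ lr9).
  - have -> : (8 * m = 5 * r * Lc * (32 * lr))%N by rewrite /m; ring.
    have -> : dl = (5 * r * Lc * r)%N by rewrite /dl; ring.
    by rewrite leq_mul2l; apply/orP; right; nia.
pose Nl a := N a :&: Bl.
have dE b : b \in Bl -> #|[set a in A | b \in Nl a]| = d b.
  move=> bBl; congr #|pred_of_set _|; apply/setP => a.
  by rewrite [in LHS]inE [in RHS]inE [b \in Nl a]in_setI bBl andbT.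
apply: (@window_case e A Bl Nl k r Lc lr) => //.
- apply/pred0P => v /=; apply/negP => /andP[vA]; rewrite inE => /andP[vB _].
  by move: dAB => /pred0P/(_ v) /=; rewrite vA vB.
- by move=> a _; rewrite subsetIr.
- by move=> a b _; rewrite inE => /andP[/Ne].
- by move=> a /Nd <-; rewrite subset_leq_card // subsetIl.
- move=> b bBl; rewrite dE //; apply/andP; split.
    have : (2 ^ m * dl <= d b)%N by move: bBl; rewrite inE => /andP[].
    by apply: leq_trans; rewrite leq_pmulr.
  case: se => syme _; apply: leq_trans (degL b); apply: subset_leq_card.
  by apply/subsetP => a; rewrite inE => /andP[_ /Ne]; rewrite inE syme.
- rewrite (eq_bigr _ dE).
  have -> : (10 * r ^ 2 * Lc * #|A| = 2 * (dl * #|A|))%N by rewrite /dl; ring.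
  lia.
Qed.

(** A cut keeps a quarter of the degree sum, which turns 40 into 10; both sides then get minimum
    degree [10 r^2 Lc], so the larger one can serve as [A]. *)
Lemma almost_regular_subgraph (e : rel V) (k r Lc lr : nat) :
  simple_graph e -> ~ contains_Kkk e k ->
  (forall x, deg e x <= 2 ^ (2 ^ Lc))%N ->
  (40 * r ^ 2 * Lc * #|V| <= \sum_x deg e x)%N -> (0 < #|V|)%N ->
  (1 < k)%N -> (0 < Lc)%N -> (9 <= lr)%N -> (r < 2 ^ lr.+1)%N ->
  (160 * (k + 1) * lr <= r)%N ->
  has_regular_subgraph e (r%:R / (160 * (k + 1)%:R * lr%:R) : R).
Proof.
move=> se noK degL avg V0 k2 Lc0 lr9 rlr rk.
have [syme irre] := se.
have [X cut] := exists_cut irre.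
have r0 : (0 < r)%N by nia.
have cV : (#|X| + #|~: X| = #|V|)%N by rewrite cardsC.
have [|||A [B [sA sB A0 B0 [degA degB]]]] :=
  @min_degree_pair V e X (~: X) (10 * r ^ 2 * Lc).
- by rewrite !muln_gt0 r0.
- by rewrite cV.
- rewrite cV; lia.
have dAB : [disjoint A & B].
  apply/pred0P => v /=; apply/negP => /andP[/(subsetP sA) vA /(subsetP sB)].
  by rewrite inE vA.
case: (leqP #|B| #|A|) => [BA|/ltnW AB].
  exact: (@bipartite_case e A B k r Lc lr).
apply: (@bipartite_case e B A k r Lc lr) => //; first by rewrite disjoint_sym.
by move=> b /degB; under eq_bigr => a _ do rewrite syme.
Qed.

End Windows.

(** * The theorem *)

(** A single edge settles the range of parameters where the required average degree is at most 1. *)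
Lemma has_regular_subgraph_edge (V : finType) (R : realFieldType) (e : rel V) x y :
  simple_graph e -> e x y -> has_regular_subgraph e (1 : R).
Proof.
move=> [syme irre] exy.
have nxy : x != y by apply: contraTneq exy => ->; rewrite irre.
pose F u v := (u == x) && (v == y) || (u == y) && (v == x).
have degx : deg F x = 1%N.
  rewrite /deg (_ : [set v | _] = [set y]) ?cards1 //.
  by apply/setP => v; rewrite !inE /F eqxx (negbTE nxy) orbF.
have degy : deg F y = 1%N.
  rewrite /deg (_ : [set v | _] = [set x]) ?cards1 //.
  by apply/setP => v; rewrite !inE /F eqxx eq_sym (negbTE nxy).
apply: (@min_degree_cleaning V R e F [set x; y] 1) => //.
- by move=> u v; rewrite /F; case: (u == x); case: (u == y); case: (v == x); case: (v == y).
- by move=> u v /orP[] /andP[/eqP-> /eqP->] //; rewrite syme.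
- by move=> u v /orP[] /andP[/eqP-> /eqP->]; rewrite !inE !eqxx ?orbT.
- move=> u; have [->|ux] := eqVneq u x; first by rewrite degx.
  have [->|uy] := eqVneq u y; first by rewrite degy.
  rewrite /deg (_ : [set v | _] = set0) ?cards0 //.
  by apply/setP => v; rewrite !inE /F (negbTE ux) (negbTE uy).
- by rewrite mulr1 ler_nat.
- by apply/set0Pn; exists x; rewrite !inE eqxx.
- rewrite mul1r ler_nat cards2 nxy (bigD1 x) //= (bigD1 y) ?(eq_sym y) //=.
  by rewrite degx degy addnA leq_addr.
Qed.

(** An inequality between natural numbers carries the bound from [rat] to the reals of the
    theorem. *)
Lemma has_regular_subgraph_nat (V : finType) (e : rel V) (p q : nat) :
  irreflexive e -> (0 < q)%N -> has_regular_subgraph e (p%:R / q%:R : rat) ->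
  exists (S : {set V}) (F : rel V), [/\ is_subgraph e S F, almost_regular 64 S F
    & (p * #|S| <= q * (2 * nedges F))%N].
Proof.
move=> irre q0 [S [F [sub reg avg]]]; exists S, F; split=> //.
case: sub => _ [symF [Fe _]].
have irrF x : F x x = false by apply/negP => /Fe; rewrite irre.
rewrite -(sum_deg symF irrF) -(ler_nat rat) !natrM.
by move: avg; rewrite mulrAC ler_pdivrMr ?ltr0n // [leRHS]mulrC.
Qed.

Close Scope ring_scope.

(* Imported only now: [Reals] rebinds the delimiter [%R] and, on [nat], [^]. *)
From Stdlib Require Import Reals Lra.

(** * Real logarithms and rounding *)

Lemma INR_leq m n : reflect (INR m <= INR n)%R (m <= n).
Proof. by apply: (iffP ssrnat.leP); [exact: le_INR | exact: INR_le]. Qed.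

Lemma INR_muln m n : INR (m * n) = (INR m * INR n)%R.
Proof. exact: mult_INR. Qed.

Lemma INR_expn m n : INR (expn m n) = (INR m ^ n)%R.
Proof.
by elim: n => [|n IH]; rewrite ?expn0 // expnS INR_muln IH.
Qed.

Lemma log2_le x y : (0 < x)%R -> (x <= y)%R -> (log2 x <= log2 y)%R.
Proof.
move=> x0 xy; rewrite /log2; apply: Rmult_le_compat_r.
  by apply/Rlt_le/Rinv_0_lt_compat; have := ln_lt_2; Lra.lra.
by case: xy => [xy|->]; [apply/Rlt_le/ln_increasing | exact: Rle_refl].
Qed.

Lemma log2_pow x n : (0 < x)%R -> log2 (x ^ n) = (INR n * log2 x)%R.
Proof. by move=> x0; rewrite /log2 ln_pow // /Rdiv Rmult_assoc. Qed.

Lemma log2_2 : log2 2 = 1%R.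
Proof. by rewrite /log2; apply: Rinv_r; have := ln_lt_2; Lra.lra. Qed.

Lemma log2_le_pow x n : (0 < x)%R -> (log2 x <= INR n)%R -> (x <= 2 ^ n)%R.
Proof.
move=> x0; rewrite -[INR n]Rmult_1_r -log2_2 -log2_pow; last by Lra.lra.
move=> h; apply: Rnot_lt_le => lt; move: h; apply: Rlt_not_le.
apply: Rmult_lt_compat_r; first by apply: Rinv_0_lt_compat; have := ln_lt_2; Lra.lra.
by apply: ln_increasing => //; apply: pow_lt; Lra.lra.
Qed.

(** From [2^3 <= 3^2] one gets [log2 x >= 3 / 2], and then [2 <= (3 / 2)^2]. *)
Lemma log2_log2_ge_half x : (3 <= x)%R -> (1 / 2 <= log2 (log2 x))%R.
Proof.
move=> x3.
have l3 : (3 / 2 <= log2 x)%R.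
  have : (INR 3 * log2 2 <= INR 2 * log2 x)%R.
    by rewrite -!log2_pow; try Lra.lra; apply: log2_le; simpl; Lra.nra.
  by rewrite log2_2 /=; Lra.lra.
have : (log2 2 <= INR 2 * log2 (log2 x))%R.
  by rewrite -log2_pow; try Lra.lra; apply: log2_le; simpl; Lra.nra.
by rewrite log2_2 /=; Lra.lra.
Qed.

Lemma log2_log2_ge1 x : (4 <= x)%R -> (1 <= log2 (log2 x))%R.
Proof.
move=> x4; rewrite -{1}log2_2; apply: log2_le; first by Lra.lra.
have -> : 2%R = log2 (2 ^ 2) by rewrite log2_pow ?log2_2 /=; Lra.lra.
by apply: log2_le; rewrite /=; Lra.lra.
Qed.

Lemma ceil_le_double x : (1 <= x)%R ->
  exists2 n : nat, 0 < n & (x <= INR n <= 2 * x)%R.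
Proof.
move=> x1; have [u1 u2] := archimed x.
have u0 : (0 < up x)%Z by apply: lt_IZR; Lra.lra.
have e : INR (Z.to_nat (up x)) = IZR (up x).
  by rewrite INR_IZR_INZ Znat.Z2Nat.id //; apply: BinInt.Z.lt_le_incl.
exists (Z.to_nat (up x)); last by rewrite e; Lra.lra.
by rewrite lt0n; apply/eqP => n0; move: e; rewrite n0 /=; Lra.lra.
Qed.

Theorem theorem5p3 :
  exists r0 : nat,
  forall (k r Delta : nat), 0 < k -> 0 < r -> r0 <= r -> 3 <= Delta ->
  forall (V : finType) (e : rel V),
    simple_graph e -> 0 < #|V| ->
    ~ contains_Kkk e k ->
    (forall x, deg e x <= Delta) ->
    (avg_deg [set: V] e >= 80 * INR r ^ 2 * log2 (log2 (INR Delta)))%R ->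
    exists (S : {set V}) (F : rel V),
      is_subgraph e S F /\ almost_regular 64 S F /\
      (avg_deg S F >= INR r / (160 * INR (k + 1) * log2 (INR r)))%R.
Proof.
(* [512 = 2^9] gives [lr >= 9] for the rounded logarithm [lr] of [r]. *)
exists 512 => k r Delta k0 r0 r512 D3 V e se V0 noK degD avg.
have [syme irre] := se.
have ln2 : (0 < ln 2)%R by have := ln_lt_2; Lra.lra.
have VR : (0 < INR #|V|)%R by apply: lt_0_INR; apply/ssrnat.ltP.
have rR : (512 <= INR r)%R by have /INR_leq := r512; rewrite /= ; Lra.lra.
set L := log2 (log2 (INR Delta)) in avg.
have arcs : (80 * INR r ^ 2 * L * INR #|V| <= INR (\sum_x deg e x))%R.
  rewrite (sum_deg syme irre) INR_muln; move: avg; rewrite /avg_deg cardsT => /Rge_le h.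
  have := Rmult_le_compat_r _ _ _ (Rlt_le _ _ VR) h.
  by rewrite /Rdiv [X in (_ <= X)%R]Rmult_assoc Rinv_l; [rewrite Rmult_1_r | Lra.lra].
have D3R : (3 <= INR Delta)%R by have /INR_leq := D3; rewrite /=; Lra.lra.
have Lhalf : (1 / 2 <= L)%R by apply: log2_log2_ge_half.
have arcsD : (INR (\sum_x deg e x) <= INR Delta * INR #|V|)%R.
  rewrite -INR_muln; apply/INR_leq; rewrite mulnC -sum_nat_const.
  by apply: leq_sum => x _.
(* For [Delta = 3] the iterated logarithm is below 1, but [L >= 1 / 2] already forces an average
   degree far above 4, and [Delta] is at least the average degree. So [L >= 1], and rounding [L] up
   to [Lc] at most doubles it, turning 80 into 40. *)
have D4 : (4 <= INR Delta)%R.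
  apply: (Rmult_le_reg_r (INR #|V|)) => //; apply: Rle_trans arcsD.
  by apply: Rle_trans arcs; apply: Rmult_le_compat_r; Lra.nra.
have L1 : (1 <= L)%R by apply: log2_log2_ge1.
have [Lc Lc0 [LLc LcL]] := ceil_le_double L1.
have degL x : deg e x <= expn 2 (expn 2 Lc).
  apply: leq_trans (degD x) _; apply/INR_leq; rewrite INR_expn.
  apply: log2_le_pow; first by Lra.lra.
  rewrite INR_expn; apply: log2_le_pow => //.
  by have := log2_le (x := 2) (y := INR Delta) ltac:(Lra.lra) ltac:(Lra.lra); rewrite log2_2; Lra.lra.
have arcs40 : 40 * expn r 2 * Lc * #|V| <= \sum_x deg e x.
  apply/INR_leq; apply: Rle_trans arcs; rewrite !INR_muln.
  apply: Rmult_le_compat_r; first Lra.lra.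
  have -> : INR 40 = 40%R by rewrite INR_IZR_INZ.
  rewrite /= Rmult_1_r; set z := (INR r * INR r)%R.
  have z0 : (0 <= z)%R by apply: Rle_0_sqr.
  by have := Rmult_le_compat_l z _ _ z0 LcL; Lra.lra.
have [x [y exy]] : exists x y, e x y.
  case: (pickP (fun p : V * V => e p.1 p.2)) => [[x y] exy|no]; first by exists x, y.
  exfalso; move: arcs; rewrite big1; last first.
    move=> x _; rewrite /deg (_ : [set y | _] = set0) ?cards0 //.
    by apply/setP => y; rewrite !inE; apply: (no (x, y)).
  apply: Rlt_not_le; rewrite /=; apply: Rmult_lt_0_compat => //; Lra.nra.
pose lr := trunc_log 2 r.
have lr9 : 9 <= lr by apply: trunc_log_max.
have rlr : r < expn 2 lr.+1 by apply: trunc_log_ltn.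
have lrR : (INR lr <= log2 (INR r))%R.
  have -> : INR lr = log2 (INR (expn 2 lr)).
    by rewrite INR_expn log2_pow /= ?log2_2; Lra.lra.
  apply: log2_le; first by apply: lt_0_INR; apply/ssrnat.ltP; rewrite expn_gt0.
  by apply/INR_leq; apply: trunc_logP.
have lr0R : (0 < INR lr)%R by apply: lt_0_INR; apply/ssrnat.ltP; apply: leq_trans lr9.
have k1R : (0 < INR (k + 1))%R by apply: lt_0_INR; apply/ssrnat.ltP; rewrite addn1.
have den0 : (0 < 160 * INR (k + 1) * log2 (INR r))%R by Lra.nra.
have finish (p q : nat) (S : {set V}) (F : rel V) : 0 < q -> is_subgraph e S F ->
    p * #|S| <= q * (2 * nedges F) ->
    (INR r / (160 * INR (k + 1) * log2 (INR r)) <= INR p / INR q)%R ->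
    (avg_deg S F >= INR r / (160 * INR (k + 1) * log2 (INR r)))%R.
  move=> q0 [Sn0 _] /INR_leq h le; apply: Rle_ge; apply: Rle_trans le _.
  have qR : (0 < INR q)%R by apply: lt_0_INR; apply/ssrnat.ltP.
  have SR : (0 < INR #|S|)%R by apply: lt_0_INR; apply/ssrnat.ltP; rewrite card_gt0.
  rewrite /avg_deg; move: h; rewrite !INR_muln => h.
  apply: (Rmult_le_reg_r (INR q * INR #|S|)); first exact: Rmult_lt_0_compat.
  have -> : (INR p / INR q * (INR q * INR #|S|) = INR p * INR #|S|)%R.
    by rewrite /Rdiv !Rmult_assoc -(Rmult_assoc (/ _)) Rinv_l ?Rmult_1_l //; Lra.lra.
  have -> : (2 * INR (nedges F) / INR #|S| * (INR q * INR #|S|) =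
    INR q * (2 * INR (nedges F)))%R.
    rewrite /Rdiv (Rmult_comm (INR q)) -!Rmult_assoc (Rmult_assoc (2 * _)) Rinv_l; last by Lra.lra.
    by rewrite Rmult_1_r Rmult_comm -Rmult_assoc.
  exact: h.
(* Either the target is at most 1 and one edge suffices, or [r] is large enough against [k] for the
   main argument. *)
case: (Rle_lt_dec (INR r) (160 * INR (k + 1) * log2 (INR r))) => [triv|nontriv].
  have := has_regular_subgraph_edge rat se exy.
  rewrite -[X in has_regular_subgraph _ X](@GRing.mulfV rat 1%:R)%R //.
  move=> /(has_regular_subgraph_nat irre (ltnSn 0))[S [F [sub reg h]]].
  exists S, F; split=> //; split=> //.
  apply: (finish 1 1 S F) => //=.
  apply: (Rmult_le_reg_r _ _ _ den0); rewrite /Rdiv Rmult_assoc Rinv_l; Lra.lra.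
have rk : 160 * (k + 1) * lr <= r.
  apply/INR_leq; rewrite !INR_muln.
  have -> : INR 160 = 160%R by rewrite INR_IZR_INZ.
  by apply: Rle_trans (Rlt_le _ _ nontriv); apply: Rmult_le_compat_l; Lra.nra.
(* An edge is a copy of [K_{1,1}], so [k = 1] is excluded. *)
have k2 : 1 < k.
  rewrite ltnNge; apply/negP => k1; have {k1} ek : k = 1 by apply/eqP; rewrite eqn_leq k1.
  apply: noK; exists [set x], [set y]; rewrite ek !cards1; split=> //.
    rewrite disjoints1 inE; apply: contraTneq exy => ->; by rewrite irre.
  by move=> a b; rewrite !inE => /eqP-> /eqP->.
have := @almost_regular_subgraph V rat e k r Lc lr se noK degL arcs40 V0 k2 Lc0 lr9 rlr rk.
rewrite -!GRing.natrM.
have q0 : 0 < 160 * (k + 1) * lr by rewrite !muln_gt0 addn1 (leq_trans _ lr9).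
move=> /(has_regular_subgraph_nat irre q0)[S [F [sub reg h]]].
exists S, F; split=> //; split=> //.
apply: (finish _ _ S F q0 sub h); rewrite !INR_muln.
have -> : INR 160 = 160%R by rewrite INR_IZR_INZ.
apply: Rmult_le_compat_l; first by Lra.lra.
(* Rounding the logarithm down to [lr] only strengthens the bound obtained. *)
apply: Rinv_le_contravar; first by apply: Rmult_lt_0_compat => //; Lra.nra.
by apply: Rmult_le_compat_l => //; Lra.nra.
Qed.
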